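(* Let $D$ be an algebra and $T:D\otimes D\to D\otimes D$ a twistor for $D$. Consider $R:=\tau\circ T$, which is a twisting map between $D$ and itself, and let $\widetilde{R}:\Omega D\otimes\Omega D\to\Omega D\otimes\Omega D$ be the extension of $R$ to $\Omega D$. Then the map $\widetilde{T}:=\tau_{gr}\circ\widetilde{R}$ is a braided twistor for $\Omega D$ in the category of graded vector spaces with braiding $\tau_{gr}$. Moreover, the algebra $(\Omega D)^{\widetilde{T}}$ (the graded vector space $\Omega D$ with multiplication $\mu_{\Omega D}\circ\widetilde{T}$) is a differential graded algebra with differential $d$, the differential of $\Omega D$.
   Context: $k$ is a field, $\otimes=\otimes_k$, algebras are associative unital $k$-algebras, $\tau(v\otimes w)=w\otimes v$ is the usual flip, and an object's identity map is denoted by the object itself. Twistor: a linear map $T:D\otimes D\to D\otimes D$ with $T(1\otimes x)=1\otimes x$, $T(x\otimes 1)=x\otimes 1$ for all $x\in D$, and, on $D\otimes D\otimes D$, $\mu_{23}\circ T_{13}\circ T_{12}=T\circ\mu_{23}$, $\mu_{12}\circ T_{13}\circ T_{23}=T\circ\mu_{12}$, $T_{12}\circ T_{23}=T_{23}\circ T_{12}$, where $T_{ij}$ is $T$ acting on factors $i,j$, $\mu_{12}=\mu\otimes D$, $\mu_{23}=D\otimes\mu$. Twisting map between an algebra $A$ and itself: a linear map $R:A\otimes A\to A\otimes A$ with $R(a\otimes 1)=1\otimes a$, $R(1\otimes a)=a\otimes 1$, $R\circ(A\otimes\mu)=(\mu\otimes A)\circ(A\otimes R)\circ(R\otimes A)$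 and $R\circ(\mu\otimes A)=(A\otimes\mu)\circ(R\otimes A)\circ(A\otimes R)$. $\Omega D$ is the graded differential algebra of universal differential forms on $D$, with differential $d$ and grading map $\varepsilon(\omega)=(-1)^{|\omega|}\omega$ for homogeneous $\omega$. By a known theorem of Cap, Schichl and Vanžura, a twisting map $R$ between $D$ and itself extends to a unique twisting map $\widetilde{R}:\Omega D\otimes\Omega D\to\Omega D\otimes\Omega D$ satisfying $\widetilde{R}\circ(d\otimes\Omega D)=(\varepsilon\otimes d)\circ\widetilde{R}$ and $\widetilde{R}\circ(\Omega D\otimes d)=(d\otimes\varepsilon)\circ\widetilde{R}$; this is ''the extension of $R$ to $\Omega D$''. The graded flip is $\tau_{gr}(\omega\otimes\zeta)=(-1)^{|\omega||\zeta|}\zeta\otimes\omega$ for homogeneous elements. Braided twistor: let $(A,\mu,u)$ be an algebra in a (strict) braided monoidal category with braiding $c$ such that $c_{A,A}^{-1}=c_{A,A}$. For a morphism $T:A\otimes A\to A\otimes A$ put $T_{13}(c):=(A\otimes c_{A,A})\circ(T\otimes A)\circ(A\otimes c_{A,A})=(c_{A,A}\otimes A)\circ(A\otimes T)\circ(c_{A,A}\otimes A)$. Then $T$ is a braided twistor for $A$ if $T\circ(u\otimes A)=u\otimes A$, $T\circ(A\otimes u)=A\otimes u$, $(A\otimes\mu)\circ T_{13}(c)\circ(T\otimes A)=T\circ(A\otimes\mu)$, $(\mu\otimes A)\circ T_{13}(c)\circ(A\otimes T)=T\circ(\mu\otimes A)$, and $(T\otimes A)\circ(A\otimes T)=(A\otimes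 T)\circ(T\otimes A)$ (so $T_{13}(c)\circ(T\otimes A)\circ(A\otimes T)=T_{13}(c)\circ(A\otimes T)\circ(T\otimes A)$). In that case $(A,\mu\circ T,u)$ is an algebra in the category, denoted $A^T$. *)

(* Defs.v *)
From HB Require Import structures.
From mathcomp Require Import all_boot all_algebra.
From mathcomp Require Import boolp.

Set Implicit Arguments.
Unset Strict Implicit.
Unset Printing Implicit Defensive.

Import GRing.Theory.
Local Open Scope ring_scope.
Local Open Scope quotient_scope.

(* Vector spaces given by formal expressions: [raw] is a type of expressions,
   each [i : obs] interprets them in a vector space, and two expressions are
   identified when no interpretation separates them.  Both the tensor product
   (interpretations = bilinear maps) and the universal differential forms
   (interpretations = algebra maps into differential graded algebras) are
   obtained this way; [tensor_universal] and [universal_forms_exists] are the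
   corresponding universal properties. *)
Record presentation (k : fieldType) := Presentation {
  raw : Type;
  obs : Type;
  oval : obs -> lmodType k;
  ev : forall i : obs, raw -> oval i;
  raw0 : raw;
  rawD : raw -> raw -> raw;
  rawZ : k -> raw -> raw;
  ev0 : forall i, ev i raw0 = 0;
  evD : forall i x y, ev i (rawD x y) = ev i x + ev i y;
  evZ : forall i a x, ev i (rawZ a x) = a *: ev i x
}.

Section Presented.
Variables (k : fieldType) (S : presentation k).

HB.instance Definition _ := gen_eqMixin (raw S).
HB.instance Definition _ := gen_choiceMixin (raw S).

Definition ev_eq (x y : raw S) : bool := `[< forall i, ev i x = ev i y >].

Lemma ev_eq_refl : reflexive ev_eq.
Proof. by move=> x; apply/asboolP. Qed.

Lemma ev_eq_sym : symmetric ev_eq.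
Proof. by move=> x y; apply/asboolP/asboolP => h i; rewrite h. Qed.

Lemma ev_eq_trans : transitive ev_eq.
Proof.
by move=> y x z /asboolP h1 /asboolP h2; apply/asboolP => i; rewrite h1 h2.
Qed.

Canonical ev_eq_equiv := EquivRel ev_eq ev_eq_refl ev_eq_sym ev_eq_trans.

Definition presented : Type := {eq_quot ev_eq}.
HB.instance Definition _ := Choice.on presented.

Definition pcls (x : raw S) : presented := \pi_({eq_quot ev_eq}) x.
Definition prep (u : presented) : raw S := repr (u : {eq_quot ev_eq}).

Lemma pclsP x y : (forall i, ev i x = ev i y) <-> pcls x = pcls y.
Proof.
split=> [h|/eqmodP/asboolP //].
by apply/eqmodP/asboolP.
Qed.

Lemma prepK u : pcls (prep u) = u.
Proof. exact: reprK. Qed.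

Definition pev (i : obs S) (u : presented) : oval i := ev i (prep u).

Lemma pev_cls i x : pev i (pcls x) = ev i x.
Proof. by have /pclsP := prepK (pcls x); apply. Qed.

Lemma pev_inj u v : (forall i, pev i u = pev i v) -> u = v.
Proof. by move=> h; rewrite -(prepK u) -(prepK v); apply/pclsP. Qed.

Lemma presented_ind (P : presented -> Prop) :
  (forall x, P (pcls x)) -> forall u, P u.
Proof. by move=> h u; rewrite -(prepK u). Qed.

Definition p0 : presented := pcls (raw0 S).
Definition pD (u v : presented) : presented := pcls (rawD (prep u) (prep v)).
Definition pZ (a : k) (u : presented) : presented := pcls (rawZ a (prep u)).
Definition pN (u : presented) : presented := pZ (-1) u.

Lemma pev0 i : pev i p0 = 0.
Proof. by rewrite pev_cls ev0. Qed.
Lemma pevD i u v : pev i (pD u v) = pev i u + pev i v.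
Proof. by rewrite pev_cls evD. Qed.
Lemma pevZ i a u : pev i (pZ a u) = a *: pev i u.
Proof. by rewrite pev_cls evZ. Qed.

Lemma pDA : associative pD.
Proof. by move=> u v w; apply: pev_inj => i; rewrite !pevD addrA. Qed.
Lemma pDC : commutative pD.
Proof. by move=> u v; apply: pev_inj => i; rewrite !pevD addrC. Qed.
Lemma p0D : left_id p0 pD.
Proof. by move=> u; apply: pev_inj => i; rewrite pevD pev0 add0r. Qed.
Lemma pND : left_inverse p0 pN pD.
Proof.
by move=> u; apply: pev_inj => i; rewrite pevD pevZ pev0 scaleN1r addNr.
Qed.

HB.instance Definition _ := GRing.isZmodule.Build presented pDA pDC p0D pND.

Lemma pZA a b u : pZ a (pZ b u) = pZ (a * b) u.
Proof. by apply: pev_inj => i; rewrite !pevZ scalerA. Qed.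
Lemma p1Z : left_id 1 pZ.
Proof. by move=> u; apply: pev_inj => i; rewrite pevZ scale1r. Qed.
Lemma pZDr : right_distributive pZ +%R.
Proof. by move=> a u v; apply: pev_inj => i; rewrite !(pevZ, pevD) scalerDr. Qed.
Lemma pZDl u : {morph pZ^~ u : a b / a + b}.
Proof. by move=> a b; apply: pev_inj => i; rewrite !(pevZ, pevD) scalerDl. Qed.

HB.instance Definition _ :=
  GRing.Zmodule_isLmodule.Build k presented pZA p1Z pZDr pZDl.

Lemma pev_linear i : linear (pev i).
Proof. by move=> a u v; rewrite pevD pevZ. Qed.
HB.instance Definition _ i :=
  GRing.isLinear.Build k presented (oval i) _ (pev i) (pev_linear i).

End Presented.

Section Tensor.
Variables (k : fieldType) (V W : lmodType k).

Record bilin := Bilin {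
  btarget : lmodType k;
  bfun : {bilinear V -> W -> btarget}
}.

(* [:: (v1, w1); ...; (vn, wn)] stands for v1 ⊗ w1 + ... + vn ⊗ wn. *)
Definition tev (b : bilin) (s : seq (V * W)) : btarget b :=
  \sum_(p <- s) bfun b p.1 p.2.

Definition tscale (a : k) (s : seq (V * W)) := [seq (a *: p.1, p.2) | p <- s].

Lemma tev0 b : tev b [::] = 0.
Proof. by rewrite /tev big_nil. Qed.
Lemma tevD b s t : tev b (s ++ t) = tev b s + tev b t.
Proof. by rewrite /tev big_cat. Qed.
Lemma tevZ b a s : tev b (tscale a s) = a *: tev b s.
Proof.
rewrite /tev big_map scaler_sumr; apply: eq_bigr => p _ /=.
by rewrite linearZl_LR.
Qed.

Definition tensor_pres := Presentation tev0 tevD tevZ.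
Definition tensor : lmodType k :=
  GRing.Lmodule.clone k (presented tensor_pres) _.

Definition tens (v : V) (w : W) : tensor := pcls (S := tensor_pres) [:: (v, w)].

Definition tpev (b : bilin) (t : tensor) : btarget b := @pev _ tensor_pres b t.

Lemma tpev_linear b : linear (tpev b).
Proof. exact: (@pev_linear _ tensor_pres b). Qed.
HB.instance Definition _ b :=
  GRing.isLinear.Build k tensor (btarget b) _ (tpev b) (tpev_linear b).

Lemma tpev_inj (t u : tensor) : (forall b, tpev b t = tpev b u) -> t = u.
Proof. exact: (@pev_inj _ tensor_pres). Qed.

Lemma tpev_tens (b : bilin) v w : tpev b (tens v w) = bfun b v w.
Proof. by rewrite /tpev pev_cls /= /tev big_seq1. Qed.

Lemma tens_linearr v : linear (tens v).
Proof.
move=> a x y; apply: tpev_inj => b.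
by rewrite linearP /= !tpev_tens linearPr.
Qed.

Lemma tens_linearl w : linear (tens^~ w).
Proof.
move=> a x y; apply: tpev_inj => b.
by rewrite linearP /= !tpev_tens linearPl.
Qed.

Lemma tens0l w : tens 0 w = 0.
Proof.
have := tens_linearl w (-1) 0 0.
by rewrite /= scaler0 addr0 scaleN1r addNr.
Qed.

Lemma tens0r v : tens v 0 = 0.
Proof.
have := tens_linearr v (-1) 0 0.
by rewrite /= scaler0 addr0 scaleN1r addNr.
Qed.

Lemma tens_suml (I : Type) (r : seq I) (P : pred I) (F : I -> V) w :
  tens (\sum_(i <- r | P i) F i) w = \sum_(i <- r | P i) tens (F i) w.
Proof.
have tD : {morph tens^~ w : x y / x + y >-> x + y}.
  by move=> x y; have := tens_linearl w 1 x y; rewrite /= !scale1r.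
by rewrite (big_morph (tens^~ w) tD (tens0l w)).
Qed.

Lemma tens_sumr (I : Type) (r : seq I) (P : pred I) (F : I -> W) v :
  tens v (\sum_(i <- r | P i) F i) = \sum_(i <- r | P i) tens v (F i).
Proof.
have tD : {morph tens v : x y / x + y >-> x + y}.
  by move=> x y; have := tens_linearr v 1 x y; rewrite /= !scale1r.
by rewrite (big_morph (tens v) tD (tens0r v)).
Qed.

Lemma tensor_span (t : tensor) :
  exists s : seq (V * W), t = \sum_(p <- s) tens p.1 p.2.
Proof.
exists (prep t); apply: tpev_inj => b; rewrite linear_sum.
by apply: eq_bigr => p _; rewrite /= tpev_tens.
Qed.

Section Lift.
Variables (U : lmodType k) (f : V -> W -> U).
Hypothesis fr : forall v, linear (f v).
Hypothesis fl : forall w, linear (f^~ w).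

Definition lift_bil : {bilinear V -> W -> U} :=
  HB.pack f (bilinear_isBilinear.Build k V W U _ _ f (conj fl fr)).

Definition tlift_fun (t : tensor) : U := tpev (Bilin lift_bil) t.

Lemma tlift_linear : linear tlift_fun.
Proof. exact: (tpev_linear (Bilin lift_bil)). Qed.

(* Opaque, so that simplification does not unfold the maps built from it;
   [tliftE] determines it by [tensor_eq]. *)
Fact tlift_exists :
  {g : {linear tensor -> U} | forall v w, g (tens v w) = f v w}.
Proof.
by exists (HB.pack_for {linear tensor -> U} tlift_fun
  (GRing.isLinear.Build k tensor U _ tlift_fun tlift_linear)) => v w;
  apply: (tpev_tens (Bilin lift_bil)).
Qed.

Definition tlift : {linear tensor -> U} := sval tlift_exists.

Lemma tliftE v w : tlift (tens v w) = f v w.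
Proof. exact: (svalP tlift_exists). Qed.

End Lift.

Lemma tensor_eq (U : lmodType k) (f g : {linear tensor -> U}) :
  (forall v w, f (tens v w) = g (tens v w)) -> f =1 g.
Proof.
move=> h t; have [s ->] := tensor_span t.
by rewrite !linear_sum; apply: eq_bigr => p _.
Qed.

Theorem tensor_universal (U : lmodType k) (f : {bilinear V -> W -> U}) :
  exists g : {linear tensor -> U}, (forall v w, g (tens v w) = f v w) /\
  forall h : {linear tensor -> U}, (forall v w, h (tens v w) = f v w) -> h =1 g.
Proof.
exists (tlift (linearPr f) (linearPl f)).
split=> [v w|h hf]; first by rewrite tliftE.
by apply: tensor_eq => v w; rewrite hf tliftE.
Qed.

End Tensor.

(* Spaces are tensored with ⊗, vectors with \ox. *)
Notation "V ⊗ W" := (tensor V W)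
  (at level 35, right associativity) : ring_scope.
Notation "v \ox w" := (tens v w)
  (at level 35, right associativity) : ring_scope.

Section TensorMaps.
Variable k : fieldType.
Implicit Types U V W : lmodType k.

Definition idl V : {linear V -> V} := idfun.

Lemma tmap_linearr V V' W W' (f : {linear V -> V'}) (g : {linear W -> W'}) v :
  linear (fun w => f v \ox g w).
Proof. by move=> a x y; rewrite linearP tens_linearr. Qed.
Lemma tmap_linearl V V' W W' (f : {linear V -> V'}) (g : {linear W -> W'}) w :
  linear (fun v => f v \ox g w).
Proof. by move=> a x y; rewrite linearP (tens_linearl (g w)). Qed.

Definition tmap V V' W W' (f : {linear V -> V'}) (g : {linear W -> W'}) :
  {linear V ⊗ W -> V' ⊗ W'} := tlift (tmap_linearr f g) (tmap_linearl f g).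

Lemma tmapE V V' W W' (f : {linear V -> V'}) (g : {linear W -> W'}) v w :
  tmap f g (v \ox w) = f v \ox g w.
Proof. by rewrite tliftE. Qed.

Definition flip V W : {linear V ⊗ W -> W ⊗ V} :=
  tlift (f := fun v w => w \ox v) (@tens_linearl k W V) (@tens_linearr k W V).

Lemma flipE V W (v : V) (w : W) : flip V W (v \ox w) = w \ox v.
Proof. by rewrite tliftE. Qed.

Section Assoc.
Variables U V W : lmodType k.

Lemma assoc1_linearr (w : W) (u : U) : linear (fun v : V => u \ox (v \ox w)).
Proof. by move=> a x y; rewrite (tens_linearl w) tens_linearr. Qed.
Lemma assoc1_linearl (w : W) (v : V) : linear (fun u : U => u \ox (v \ox w)).
Proof. exact: tens_linearl. Qed.

Definition assoc1 (w : W) : {linear U ⊗ V -> U ⊗ (V ⊗ W)} :=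
  tlift (assoc1_linearr w) (assoc1_linearl w).

Lemma assoc1E u v w : assoc1 w (u \ox v) = u \ox (v \ox w).
Proof. exact: tliftE. Qed.

Lemma assoc_linearr (t : U ⊗ V) : linear (fun w => assoc1 w t).
Proof.
move=> a x y; move: t.
apply: (tensor_eq (g := a \*: assoc1 x \+ assoc1 y)) => u v.
rewrite -[RHS]/(a *: assoc1 x _ + assoc1 y _).
by rewrite !assoc1E (tens_linearr v) tens_linearr.
Qed.
Lemma assoc_linearl (w : W) : linear (assoc1 w).
Proof. exact: linearP. Qed.

Definition assoc : {linear (U ⊗ V) ⊗ W -> U ⊗ (V ⊗ W)} :=
  tlift assoc_linearr assoc_linearl.

Lemma assocE u v w : assoc ((u \ox v) \ox w) = u \ox (v \ox w).
Proof. by rewrite tliftE assoc1E. Qed.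

Lemma unassoc1_linearr (u : U) (v : V) : linear (fun w : W => (u \ox v) \ox w).
Proof. exact: tens_linearr. Qed.
Lemma unassoc1_linearl (u : U) (w : W) : linear (fun v : V => (u \ox v) \ox w).
Proof. by move=> a x y; rewrite tens_linearr (tens_linearl w). Qed.

Definition unassoc1 (u : U) : {linear V ⊗ W -> (U ⊗ V) ⊗ W} :=
  tlift (unassoc1_linearr u) (unassoc1_linearl u).

Lemma unassoc1E u v w : unassoc1 u (v \ox w) = (u \ox v) \ox w.
Proof. exact: tliftE. Qed.

Lemma unassoc_linearr (u : U) : linear (unassoc1 u).
Proof. exact: linearP. Qed.
Lemma unassoc_linearl (t : V ⊗ W) : linear (fun u => unassoc1 u t).
Proof.
move=> a x y; move: t.
apply: (tensor_eq (g := a \*: unassoc1 x \+ unassoc1 y)) => v w.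
rewrite -[RHS]/(a *: unassoc1 x _ + unassoc1 y _).
by rewrite !unassoc1E (tens_linearl v) (tens_linearl w).
Qed.

Definition unassoc : {linear U ⊗ (V ⊗ W) -> (U ⊗ V) ⊗ W} :=
  tlift unassoc_linearr unassoc_linearl.

Lemma unassocE u v w : unassoc (u \ox (v \ox w)) = (u \ox v) \ox w.
Proof. by rewrite tliftE unassoc1E. Qed.

End Assoc.

(* V ⊗ V ⊗ V is bracketed to the left: f12 = f ⊗ V and f23 = V ⊗ f. *)
Definition on12 V W (f : {linear V ⊗ V -> W}) : {linear (V ⊗ V) ⊗ V -> W ⊗ V} :=
  tmap f (idl V).

Definition on23 V (f : {linear V ⊗ V -> V ⊗ V}) :
  {linear (V ⊗ V) ⊗ V -> (V ⊗ V) ⊗ V} :=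
  unassoc V V V \o tmap (idl V) f \o assoc V V V.

Definition mul23 V (m : {linear V ⊗ V -> V}) : {linear (V ⊗ V) ⊗ V -> V ⊗ V} :=
  tmap (idl V) m \o assoc V V V.

Definition is_algebra V (m : {linear V ⊗ V -> V}) (e : V) : Prop :=
  [/\ forall x y z, m (m (x \ox y) \ox z) = m (x \ox m (y \ox z)),
      forall x, m (e \ox x) = x
    & forall x, m (x \ox e) = x].

End TensorMaps.

(* The library's [algType k] excludes the zero algebra and fixes one product per
   carrier; [algebra_of_algType] embeds it here. *)
Record algebra (k : fieldType) := MkAlgebra {
  asort :> lmodType k;
  amul : {linear asort ⊗ asort -> asort};
  aone : asort;
  algebraP : is_algebra amul aone
}.
Arguments amul {k}.
Arguments aone {k}.

Section OfAlgType.
Variables (k : fieldType) (A : algType k).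

Lemma mulr_linearr (x : A) : linear ( *%R x).
Proof. by move=> a y z; rewrite mulrDr scalerAr. Qed.
Lemma mulr_linearl (x : A) : linear ( *%R^~ x).
Proof. by move=> a y z; rewrite mulrDl scalerAl. Qed.

Definition mulT : {linear A ⊗ A -> A} := tlift mulr_linearr mulr_linearl.

Lemma mulT_algebra : is_algebra mulT 1.
Proof. by split=> *; rewrite !tliftE (mulrA, mul1r, mulr1). Qed.

Definition algebra_of_algType : algebra k := MkAlgebra mulT_algebra.

End OfAlgType.

Section Twistors.
Variables (k : fieldType) (A : algebra k).
Local Notation m := (amul A).
Local Notation e := (aone A).

Definition is_twisting (R : {linear A ⊗ A -> A ⊗ A}) : Prop :=
  [/\ forall a, R (a \ox e) = e \ox a,
      forall a, R (e \ox a) = a \ox e,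
      R \o mul23 m =1 on12 m \o on23 R \o on12 R
    & R \o on12 m =1 mul23 m \o on12 R \o on23 R].

Definition on13 (c T : {linear A ⊗ A -> A ⊗ A}) :
  {linear (A ⊗ A) ⊗ A -> (A ⊗ A) ⊗ A} :=
  on23 c \o on12 T \o on23 c.

Definition is_braided_twistor (c T : {linear A ⊗ A -> A ⊗ A}) : Prop :=
  [/\ forall x, T (e \ox x) = e \ox x,
      forall x, T (x \ox e) = x \ox e,
      mul23 m \o on13 c T \o on12 T =1 T \o mul23 m,
      on12 m \o on13 c T \o on23 T =1 T \o on12 m
    & on12 T \o on23 T =1 on23 T \o on12 T].

(* T13 in the definition of an ordinary twistor is T13(τ). *)
Definition is_twistor : {linear A ⊗ A -> A ⊗ A} -> Prop :=
  is_braided_twistor (flip A A).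

End Twistors.

(* An ℕ-grading V = ⊕_n V_n, given by the projections onto the V_n. *)
Record grading (k : fieldType) (V : lmodType k) := Grading {
  hcomp : nat -> {linear V -> V};
  hcomp_orth : forall i n v,
    hcomp i (hcomp n v) = if i == n then hcomp n v else 0;
  hcomp_sum : forall v, exists N, v = \sum_(n < N) hcomp n v
}.

Definition homog (k : fieldType) (V : lmodType k) (G : grading V) n v : Prop :=
  hcomp G n v = v.

Definition graded_map (k : fieldType) (V W : lmodType k) (G : grading V)
    (H : grading W) (f : {linear V -> W}) : Prop :=
  forall n v, f (hcomp G n v) = hcomp H n (f v).

Section Gradings.
Variable k : fieldType.
Implicit Types V W U : lmodType k.

Definition hbound V (G : grading V) (v : V) : nat :=
  projT1 (cid (hcomp_sum G v)).

Lemma hbound_sum V (G : grading V) v : v = \sum_(n < hbound G v) hcomp G n v.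
Proof. exact: projT2 (cid (hcomp_sum G v)). Qed.

Lemma hcomp_homog V (G : grading V) n v : homog G n (hcomp G n v).
Proof. by rewrite /homog hcomp_orth eqxx. Qed.

Lemma homog_hcomp V (G : grading V) i n v :
  homog G n v -> hcomp G i v = if i == n then v else 0.
Proof. by move=> hv; rewrite -{1}hv hcomp_orth hv. Qed.

Lemma hcomp_ge V (G : grading V) v N :
  v = \sum_(n < N) hcomp G n v -> forall n, (N <= n)%N -> hcomp G n v = 0.
Proof.
move=> e n leNn; rewrite e linear_sum big1 // => i _.
by rewrite hcomp_orth gtn_eqF // (leq_trans (ltn_ord i)).
Qed.

Lemma sum_trunc (U : zmodType) (F : nat -> U) N M : (N <= M)%N ->
  (forall n, (N <= n)%N -> F n = 0) -> \sum_(n < M) F n = \sum_(n < N) F n.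
Proof.
move=> leNM F0; rewrite -!(big_mkord xpredT F).
rewrite (@big_cat_nat _ _ _ N 0 M) //= [X in _ + X]big_nat.
by rewrite [X in _ + X]big1 ?addr0 // => n /andP[h _]; apply: F0.
Qed.

Lemma hcomp_sum_ge V (G : grading V) v N :
  (forall n, (N <= n)%N -> hcomp G n v = 0) -> v = \sum_(n < N) hcomp G n v.
Proof.
move=> vN; have vM := hcomp_ge (hbound_sum G v); rewrite {1}(hbound_sum G v).
rewrite -(@sum_trunc _ (fun n => hcomp G n v) N (maxn (hbound G v) N)) //.
  by rewrite (@sum_trunc _ (fun n => hcomp G n v) (hbound G v)) // leq_maxl.
exact: leq_maxr.
Qed.

Lemma hcomp_sumW V (G : grading V) v N M : (N <= M)%N ->
  v = \sum_(n < N) hcomp G n v -> v = \sum_(n < M) hcomp G n v.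
Proof.
move=> leNM /hcomp_ge h; apply: hcomp_sum_ge => n leMn.
exact: h (leq_trans leNM leMn).
Qed.

(* The linear map sending v to F n v for v homogeneous of degree n. *)
Section DegreeWise.
Variables (V U : lmodType k) (G : grading V) (F : nat -> V -> U).
Hypothesis F_linear : forall n, linear (F n).

Definition degwise (v : V) : U := \sum_(n < hbound G v) F n (hcomp G n v).

Let F0 n : F n 0 = 0.
Proof.
have := F_linear n 1 0 0; rewrite !scale1r addr0 => h.
by apply: (addrI (F n 0)); rewrite -h addr0.
Qed.

Lemma degwiseE N v : v = \sum_(n < N) hcomp G n v ->
  degwise v = \sum_(n < N) F n (hcomp G n v).
Proof.
move=> /hcomp_ge vN; have vM := hcomp_ge (hbound_sum G v).
pose H n := F n (hcomp G n v); rewrite -[LHS]/(\sum_(n < hbound G v) H n).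
rewrite -[RHS]/(\sum_(n < N) H n).
rewrite -(@sum_trunc _ H N (maxn (hbound G v) N)) ?leq_maxr //.
  rewrite -(@sum_trunc _ H (hbound G v) (maxn (hbound G v) N)) ?leq_maxl //.
  by move=> n le; rewrite /H vM.
by move=> n le; rewrite /H vN.
Qed.

Lemma degwise_linear : linear degwise.
Proof.
move=> a v w; pose N := maxn (hbound G v) (hbound G w).
have hv : v = \sum_(n < N) hcomp G n v.
  exact: hcomp_sumW (leq_maxl _ _) (hbound_sum G v).
have hw : w = \sum_(n < N) hcomp G n w.
  exact: hcomp_sumW (leq_maxr _ _) (hbound_sum G w).
rewrite (degwiseE hv) (degwiseE hw) (@degwiseE N).
  rewrite scaler_sumr -big_split; apply: eq_bigr => n _ /=.
  by rewrite linearP F_linear.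
rewrite {1}hv {1}hw scaler_sumr -big_split; apply: eq_bigr => n _ /=.
by rewrite linearP.
Qed.

Lemma degwise_homog n v : homog G n v -> degwise v = F n v.
Proof.
move=> hv; rewrite (@degwiseE n.+1).
  rewrite big_ord_recr /= hv big1 ?add0r // => i _.
  by rewrite (homog_hcomp _ hv) ltn_eqF.
by apply: hcomp_sum_ge => i lt; rewrite (homog_hcomp _ hv) gtn_eqF.
Qed.

End DegreeWise.

Lemma gsign_linear V n : linear (fun v : V => (-1) ^+ n *: v).
Proof. by move=> a x y; rewrite scalerDr !scalerA mulrC. Qed.

Definition gsign V (G : grading V) : V -> V :=
  degwise G (fun n v => (-1) ^+ n *: v).
HB.instance Definition _ V (G : grading V) :=
  GRing.isLinear.Build k V V _ (gsign G) (degwise_linear G (@gsign_linear V)).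

Lemma gsignE V (G : grading V) n v :
  homog G n v -> gsign G v = (-1) ^+ n *: v.
Proof. exact: (degwise_homog (@gsign_linear V)). Qed.

Section GradedFlip.
Variables (V W : lmodType k) (G : grading V) (H : grading W).

Let flip0 (i : nat) (v : V) (n : nat) (w : W) : W ⊗ V :=
  (-1) ^+ (i * n) *: (w \ox v).

Let flip1 (i : nat) (v : V) (w : W) : W ⊗ V := degwise H (flip0 i v) w.

Lemma gflip0_linear i v n : linear (flip0 i v n).
Proof.
move=> a x y; rewrite /flip0 (tens_linearl v) scalerDr !scalerA.
by rewrite [a * _]mulrC.
Qed.

Lemma gflip1_linear i w : linear (flip1 i ^~ w).
Proof.
move=> a x y; rewrite /flip1 /degwise scaler_sumr -big_split.
apply: eq_bigr => n _ /=.
by rewrite /flip0 tens_linearr scalerDr !scalerA [a * _]mulrC.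
Qed.

Lemma gflip_linearr v : linear (fun w => degwise G (fun i v => flip1 i v w) v).
Proof.
move=> a x y; rewrite /degwise scaler_sumr -big_split.
apply: eq_bigr => n _ /=.
exact: (degwise_linear H (gflip0_linear _ _)).
Qed.

Lemma gflip_linearl w : linear (degwise G (fun i v => flip1 i v w)).
Proof. by apply: degwise_linear => i; apply: gflip1_linear. Qed.

Definition gflip : {linear V ⊗ W -> W ⊗ V} :=
  tlift gflip_linearr gflip_linearl.

Lemma gflipE i n v w : homog G i v -> homog H n w ->
  gflip (v \ox w) = (-1) ^+ (i * n) *: (w \ox v).
Proof.
move=> hv hw; rewrite tliftE (degwise_homog _ hv); last first.
  by move=> j; apply: gflip1_linear.
by rewrite /flip1 (degwise_homog (gflip0_linear i v) hw).
Qed.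

End GradedFlip.

Section TensorGrading.
Variables (V W : lmodType k) (G : grading V) (H : grading W).

Definition tcomp (n : nat) (t : V ⊗ W) : V ⊗ W :=
  \sum_(i < n.+1) tmap (hcomp G i) (hcomp H (n - i)%N) t.

Lemma tcomp_linear n : linear (tcomp n).
Proof.
move=> a x y; rewrite /tcomp scaler_sumr -big_split; apply: eq_bigr => i _ /=.
exact: linearP.
Qed.
HB.instance Definition _ n :=
  GRing.isLinear.Build k (V ⊗ W) (V ⊗ W) _ (tcomp n) (tcomp_linear n).

Lemma tcomp_homog n i j v w : homog G i v -> homog H j w ->
  tcomp n (v \ox w) = if n == (i + j)%N then v \ox w else 0.
Proof.
move=> hv hw; rewrite /tcomp; case: eqP => [->|ne].
  have lt : (i < (i + j).+1)%N by rewrite ltnS leq_addr.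
  rewrite (bigD1 (Ordinal lt)) //= tmapE addKn hv hw big1 ?addr0 // => l ne.
  rewrite tmapE (homog_hcomp _ hv) ifN ?tens0l //.
rewrite big1 // => l _; rewrite tmapE (homog_hcomp _ hv).
case: eqP => [li|_]; last by rewrite tens0l.
rewrite (homog_hcomp _ hw); case: eqP => [lj|_]; last by rewrite tens0r.
by case: ne; rewrite -lj -li subnKC // -ltnS.
Qed.

(* Every tensor is a sum of tensors of homogeneous elements. *)
Lemma tensor_hspan (t : V ⊗ W) : exists s : seq (nat * V * (nat * W)),
  (forall p, p \in s -> homog G p.1.1 p.1.2 /\ homog H p.2.1 p.2.2) /\
  t = \sum_(p <- s) p.1.2 \ox p.2.2.
Proof.
have [s ->] := tensor_span t; elim: s => [|[v w] s [r [hr er]]].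
  by exists [::]; rewrite !big_nil.
exists ([seq ((i, hcomp G i v), (j, hcomp H j w)) |
          i <- iota 0 (hbound G v), j <- iota 0 (hbound H w)] ++ r); split.
  move=> p; rewrite mem_cat => /orP[/allpairsP[[i j] [_ _ ->]] /=|/hr //].
  by split; apply: hcomp_homog.
rewrite big_cons big_cat er /= big_allpairs_dep; congr (_ + _).
rewrite {1}(hbound_sum G v) {1}(hbound_sum H w).
rewrite tens_suml -(big_mkord xpredT (fun i => hcomp G i v \ox _)).
rewrite /index_iota subn0; apply: eq_bigr => i _.
rewrite tens_sumr -(big_mkord xpredT (fun j => _ \ox hcomp H j w)).
by rewrite /index_iota subn0.
Qed.

Lemma tcomp_orth i n t : tcomp i (tcomp n t) = if i == n then tcomp n t else 0.
Proof.
have [s [hs ->]] := tensor_hspan t.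
have -> : tcomp n (\sum_(p <- s) p.1.2 \ox p.2.2) =
    \sum_(p <- s | n == (p.1.1 + p.2.1)%N) p.1.2 \ox p.2.2.
  rewrite linear_sum [RHS]big_mkcond big_seq [RHS]big_seq; apply: eq_bigr => p /hs.
  by case=> h1 h2; apply: tcomp_homog.
rewrite linear_sum; case: eqP => [->|ne].
  rewrite big_seq_cond [RHS]big_seq_cond; apply: eq_bigr => p /andP[/hs[h1 h2]].
  by move=> e; rewrite /= (tcomp_homog _ h1 h2) e.
rewrite big_seq_cond big1 // => p /andP[/hs[h1 h2] /eqP e].
by rewrite /= (tcomp_homog _ h1 h2) -e ifN //; apply/eqP.
Qed.

Lemma tcomp_sum t : exists N, t = \sum_(n < N) tcomp n t.
Proof.
have [s [hs ->]] := tensor_hspan t.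
exists (\max_(p <- s) (p.1.1 + p.2.1).+1)%N.
set N := (X in \sum_(n < X) _).
transitivity (\sum_(n < N) \sum_(p <- s) tcomp n (p.1.2 \ox p.2.2)); last first.
  by apply: eq_bigr => n _; rewrite linear_sum.
rewrite exchange_big /= big_seq [RHS]big_seq; apply: eq_bigr => p ps.
have [h1 h2] := hs p ps.
have lt : (p.1.1 + p.2.1 < \max_(p <- s) (p.1.1 + p.2.1).+1)%N.
  by rewrite (big_rem p) //= leq_maxl.
rewrite (bigD1 (Ordinal lt)) //= (tcomp_homog _ h1 h2) eqxx big1 ?addr0 //.
by move=> l ne; rewrite (tcomp_homog _ h1 h2) ifN.
Qed.

(* (V ⊗ W)_n = ⊕_(i + j = n) V_i ⊗ W_j. *)
Definition tgrading : grading (V ⊗ W) := Grading tcomp_orth tcomp_sum.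

End TensorGrading.

Definition is_dga V (G : grading V) (m : {linear V ⊗ V -> V}) (e : V)
    (d : {linear V -> V}) : Prop :=
  [/\ is_algebra m e,
      homog G 0 e
      /\ (forall i j x y,
            homog G i x -> homog G j y -> homog G (i + j)%N (m (x \ox y))),
      forall n x, homog G n x -> homog G n.+1 (d x),
      forall x, d (d x) = 0
    & forall n x y, homog G n x ->
        d (m (x \ox y)) = m (d x \ox y) + (-1) ^+ n *: m (x \ox d y)].

End Gradings.

Record dga (k : fieldType) := Dga {
  dalg :> algebra k;
  dgr : grading dalg;
  dd : {linear dalg -> dalg};
  dgaP : is_dga dgr (amul dalg) (aone dalg) dd
}.
Arguments dgr {k}.
Arguments dd {k}.

Section Forms.
Variable k : fieldType.

Definition alg_mor (A B : algebra k) (f : {linear A -> B}) : Prop :=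
  f (aone A) = aone B /\
  forall x y, f (amul A (x \ox y)) = amul B (f x \ox f y).

Definition dga_mor (X Y : dga k) (f : {linear X -> Y}) : Prop :=
  [/\ alg_mor f, graded_map (dgr X) (dgr Y) f
    & forall x, f (dd X x) = dd Y (f x)].

(* An algebra map D -> X^0, X^0 being the degree 0 part of X. *)
Definition alg_mor0 (D : algebra k) (X : dga k) (f : {linear D -> X}) : Prop :=
  alg_mor f /\ forall a, homog (dgr X) 0 (f a).

(* Om, with i : D -> Om, is the algebra of universal differential forms on D:
   Om^0 = D, and every algebra map from D to the degree 0 part of a differential
   graded algebra extends uniquely to a DGA morphism on Om. *)
Definition universal_forms (D : algebra k) (Om : dga k) (i : {linear D -> Om}) :
    Prop :=
  [/\ alg_mor0 i,
      injective i,
      forall x, homog (dgr Om) 0 x -> exists a, x = i a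
    & forall (X : dga k) (f : {linear D -> X}), alg_mor0 f ->
        exists g : {linear Om -> X}, [/\ dga_mor g, g \o i =1 f &
          forall h : {linear Om -> X}, dga_mor h -> h \o i =1 f -> h =1 g]].

(* Rt is the extension of the twisting map R from D to Om. *)
Definition is_extension (D : algebra k) (Om : dga k) (i : {linear D -> Om})
    (R : {linear D ⊗ D -> D ⊗ D}) (Rt : {linear Om ⊗ Om -> Om ⊗ Om}) : Prop :=
  [/\ is_twisting Rt,
      Rt \o tmap i i =1 tmap i i \o R,
      Rt \o tmap (dd Om) (idl Om) =1 tmap (gsign (dgr Om)) (dd Om) \o Rt
    & Rt \o tmap (idl Om) (dd Om) =1 tmap (dd Om) (gsign (dgr Om)) \o Rt].

(* A braided twistor in the category of graded vector spaces, whose morphisms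
   are the linear maps of degree 0, with the braiding [gflip]. *)
Definition is_graded_twistor (A : dga k) (T : {linear A ⊗ A -> A ⊗ A}) : Prop :=
  graded_map (tgrading (dgr A) (dgr A)) (tgrading (dgr A) (dgr A)) T /\
  is_braided_twistor (gflip (dgr A) (dgr A)) T.

End Forms.

(* Existence of universal differential forms: expressions in the elements of D
   and the operations of a differential graded algebra, two expressions being
   identified when they agree in every DGA X under every algebra map D -> X^0. *)
Section Existence.
Variables (k : fieldType) (D : algebra k).

Lemma dga_algebra (X : dga k) : is_algebra (amul X) (aone X).
Proof. by case: (dgaP X). Qed.

Lemma dga_one (X : dga k) : homog (dgr X) 0 (aone X).
Proof. by case: (dgaP X) => _ []. Qed.

Lemma dga_mul (X : dga k) i j x y : homog (dgr X) i x -> homog (dgr X) j y ->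
  homog (dgr X) (i + j)%N (amul X (x \ox y)).
Proof. by case: (dgaP X) => _ [] _ h _ _ _; apply: h. Qed.

Lemma dga_d (X : dga k) n x : homog (dgr X) n x -> homog (dgr X) n.+1 (dd X x).
Proof. by case: (dgaP X) => _ _ h _ _; apply: h. Qed.

Lemma dga_mul_le (X : dga k) N M x y :
  (forall n, (N <= n)%N -> hcomp (dgr X) n x = 0) ->
  (forall n, (M <= n)%N -> hcomp (dgr X) n y = 0) ->
  forall n, (N + M <= n)%N -> hcomp (dgr X) n (amul X (x \ox y)) = 0.
Proof.
move=> /hcomp_sum_ge -> /hcomp_sum_ge -> n le.
rewrite tens_suml !linear_sum big1 //= => i _.
rewrite tens_sumr !linear_sum big1 //= => j _.
rewrite (homog_hcomp _ (dga_mul (hcomp_homog _ _ _) (hcomp_homog _ _ _))).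
by rewrite gtn_eqF // (leq_trans _ le) // -addnS leq_add // ltnW.
Qed.

Lemma dga_mul0 (X : dga k) x y :
  hcomp (dgr X) 0 (amul X (x \ox y)) =
  amul X (hcomp (dgr X) 0 x \ox hcomp (dgr X) 0 y).
Proof.
have aux z : exists N, z = \sum_(n < N.+1) hcomp (dgr X) n z.
  exists (hbound (dgr X) z).
  exact: hcomp_sumW (leqnSn _) (hbound_sum (dgr X) z).
have [N eN] := aux x; have [M eM] := aux y.
rewrite {1}eN {1}eM tens_suml !linear_sum big_ord_recl /=.
rewrite tens_sumr !linear_sum big_ord_recl /=.
rewrite (homog_hcomp _ (dga_mul (hcomp_homog _ _ _) (hcomp_homog _ _ _))) /=.
rewrite big1 ?addr0 => [|j _]; last first.
  by rewrite (homog_hcomp _ (dga_mul (hcomp_homog _ _ _) (hcomp_homog _ _ _))).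
rewrite big1 ?addr0 // => i _.
rewrite tens_sumr !linear_sum big1 // => j _ /=.
by rewrite (homog_hcomp _ (dga_mul (hcomp_homog _ _ _) (hcomp_homog _ _ _))).
Qed.

Lemma dga_hd (X : dga k) n x :
  hcomp (dgr X) n (dd X x) = if n is p.+1 then dd X (hcomp (dgr X) p x) else 0.
Proof.
have [N e] := hcomp_sum (dgr X) x; rewrite [in LHS]e !linear_sum /=.
under eq_bigr => i _ do rewrite (homog_hcomp _ (dga_d (hcomp_homog _ _ _))).
case: n => [|p]; first by rewrite big1.
rewrite [in RHS]e !linear_sum /=; apply: eq_bigr => i _.
by rewrite hcomp_orth eqSS; case: ifP => _; rewrite ?linear0.
Qed.

Inductive fexpr : Type :=
  | Fgen of D
  | Fzero
  | Fadd of fexpr & fexpr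
  | Fscale of k & fexpr
  | Fmul of fexpr & fexpr
  | Fdiff of fexpr
  | Fcomp of nat & fexpr.

Record fobs := FObs {
  fdga : dga k;
  fmap : {linear D -> fdga};
  fmapP : alg_mor0 fmap
}.

Fixpoint fev (i : fobs) (t : fexpr) : fdga i :=
  match t with
  | Fgen a => fmap i a
  | Fzero => 0
  | Fadd s t => fev i s + fev i t
  | Fscale a t => a *: fev i t
  | Fmul s t => amul (fdga i) (fev i s \ox fev i t)
  | Fdiff t => dd (fdga i) (fev i t)
  | Fcomp n t => hcomp (dgr (fdga i)) n (fev i t)
  end.

Definition forms_pres : presentation k :=
  @Presentation k fexpr fobs (fun i => asort (fdga i)) fev Fzero Fadd Fscale
    (fun=> erefl) (fun _ _ _ => erefl) (fun _ _ _ => erefl).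

Definition forms : lmodType k :=
  GRing.Lmodule.clone k (presented forms_pres) _.

Definition fcls (t : fexpr) : forms := @pcls _ forms_pres t.
Definition fpev (i : fobs) (u : forms) : fdga i := @pev _ forms_pres i u.

Lemma fpev_linear i : linear (fpev i).
Proof. exact: (@pev_linear _ forms_pres i). Qed.
HB.instance Definition _ i :=
  GRing.isLinear.Build k forms (fdga i) _ (fpev i) (fpev_linear i).

Lemma fpev_inj (u v : forms) : (forall i, fpev i u = fpev i v) -> u = v.
Proof. exact: (@pev_inj _ forms_pres). Qed.

Lemma fpev_cls i t : fpev i (fcls t) = fev i t.
Proof. exact: (@pev_cls _ forms_pres). Qed.

Lemma fclsP (u : forms) : exists t, u = fcls t.
Proof. by exists (prep u); rewrite /fcls prepK. Qed.

Definition frep (u : forms) : fexpr := @prep _ forms_pres u.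

Lemma fpev_rep i u : fev i (frep u) = fpev i u.
Proof. by []. Qed.

Definition fcomp n (u : forms) : forms := fcls (Fcomp n (frep u)).
Definition fmul (u v : forms) : forms := fcls (Fmul (frep u) (frep v)).
Definition fdiff (u : forms) : forms := fcls (Fdiff (frep u)).
Definition fgen (a : D) : forms := fcls (Fgen a).

Lemma fpev_comp i n u : fpev i (fcomp n u) = hcomp (dgr (fdga i)) n (fpev i u).
Proof. by rewrite fpev_cls /= fpev_rep. Qed.
Lemma fpev_mul i u v :
  fpev i (fmul u v) = amul (fdga i) (fpev i u \ox fpev i v).
Proof. by rewrite fpev_cls /= !fpev_rep. Qed.
Lemma fpev_diff i u : fpev i (fdiff u) = dd (fdga i) (fpev i u).
Proof. by rewrite fpev_cls /= fpev_rep. Qed.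
Lemma fpev_gen i a : fpev i (fgen a) = fmap i a.
Proof. by rewrite fpev_cls. Qed.

Lemma fpevP i a u v : fpev i (a *: u + v) = a *: fpev i u + fpev i v.
Proof. exact: fpev_linear. Qed.

Lemma fcomp_linear n : linear (fcomp n).
Proof.
by move=> a u v; apply: fpev_inj => i; rewrite !(fpev_comp, fpevP) linearP.
Qed.
HB.instance Definition _ n :=
  GRing.isLinear.Build k forms forms _ (fcomp n) (fcomp_linear n).

Lemma fdiff_linear : linear fdiff.
Proof.
by move=> a u v; apply: fpev_inj => i; rewrite !(fpev_diff, fpevP) linearP.
Qed.
HB.instance Definition _ :=
  GRing.isLinear.Build k forms forms _ fdiff fdiff_linear.

Lemma fgen_linear : linear fgen.
Proof.
by move=> a u v; apply: fpev_inj => i; rewrite !(fpev_gen, fpevP) linearP.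
Qed.
HB.instance Definition _ := GRing.isLinear.Build k D forms _ fgen fgen_linear.

Lemma fmul_linearr u : linear (fmul u).
Proof.
move=> a x y; apply: fpev_inj => i.
by rewrite !(fpev_mul, fpevP) (tens_linearr (fpev i u)) linearP.
Qed.
Lemma fmul_linearl v : linear (fmul^~ v).
Proof.
move=> a x y; apply: fpev_inj => i.
by rewrite /= !(fpev_mul, fpevP) (tens_linearl (fpev i v)) linearP.
Qed.

Definition fmult : {linear forms ⊗ forms -> forms} :=
  tlift fmul_linearr fmul_linearl.

Lemma fmultE u v : fmult (u \ox v) = fmul u v.
Proof. exact: tliftE. Qed.

Lemma fev_bound t :
  exists N, forall i n, (N <= n)%N -> hcomp (dgr (fdga i)) n (fev i t) = 0.
Proof.
elim: t => [a||s [N hN] t [M hM]|a t [N hN]|s [N hN] t [M hM]|t [N hN]|m t _].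
- exists 1%N => i [|n] // _ /=.
  by rewrite (homog_hcomp _ (proj2 (fmapP i) a)).
- by exists 0%N => i n _; rewrite /= linear0.
- exists (maxn N M) => i n; rewrite geq_max => /andP[h1 h2].
  by rewrite /= linearD hN // hM // addr0.
- by exists N => i n h; rewrite /= linearZ /= hN // scaler0.
- by exists (N + M)%N => i n; apply: (dga_mul_le (hN i) (hM i)).
- by exists N.+1 => i [|n] // h; rewrite /= dga_hd hN // linear0.
- by exists m.+1 => i n h; rewrite /= hcomp_orth gtn_eqF.
Qed.

Lemma fcomp_orth i n u : fcomp i (fcomp n u) = if i == n then fcomp n u else 0.
Proof.
apply: fpev_inj => j; rewrite !fpev_comp hcomp_orth.
by case: eqP => _; rewrite ?fpev_comp ?linear0.
Qed.

Lemma fcomp_sum u : exists N, u = \sum_(n < N) fcomp n u.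
Proof.
have [t ->] := fclsP u; have [N hN] := fev_bound t.
exists N; apply: fpev_inj => i; rewrite linear_sum /=.
under eq_bigr => n _ do rewrite fpev_comp.
by apply: hcomp_sum_ge => n h; rewrite fpev_cls hN.
Qed.

Definition fgrading : grading forms := Grading fcomp_orth fcomp_sum.

Lemma fhomogP n u :
  homog fgrading n u <-> forall i, homog (dgr (fdga i)) n (fpev i u).
Proof.
split=> [h i|h]; last by apply: fpev_inj => i; rewrite fpev_comp h.
by rewrite /homog -fpev_comp -[in RHS]h.
Qed.

Definition fone : forms := fgen (aone D).

Lemma fpev_one i : fpev i fone = aone (fdga i).
Proof. by rewrite fpev_gen; have [[]] := fmapP i. Qed.

Lemma forms_algebra : is_algebra fmult fone.
Proof.
split=> [x y z|x|x]; apply: fpev_inj => i;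
  have [mA m1 mr1] := dga_algebra (fdga i);
  by rewrite !fmultE !fpev_mul ?fpev_one // ?fpev_mul.
Qed.

Definition forms_alg : algebra k := MkAlgebra forms_algebra.

Lemma forms_is_dga : is_dga fgrading fmult fone fdiff.
Proof.
split.
- exact: forms_algebra.
- split=> [|i j x y /fhomogP hx /fhomogP hy]; apply/fhomogP => l.
    by rewrite fpev_one; apply: dga_one.
  by rewrite fmultE fpev_mul; apply: dga_mul.
- move=> n x /fhomogP hx; apply/fhomogP => l.
  by rewrite fpev_diff; apply: dga_d.
- move=> x; apply: fpev_inj => i; rewrite !fpev_diff linear0.
  by case: (dgaP (fdga i)).
- move=> n x y /fhomogP hx; apply: fpev_inj => i.
  case: (dgaP (fdga i)) => _ _ _ _ h.
  rewrite linearD linearZ /= !fmultE fpev_diff !fpev_mul !fpev_diff.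
  exact: h.
Qed.

Definition forms_dga : dga k := @Dga k forms_alg fgrading fdiff forms_is_dga.

(* D as a DGA concentrated in degree 0. *)
Definition triv_comp (n : nat) : {linear D -> D} :=
  if n is 0 then idl D else \0.

Lemma triv_orth i n v :
  triv_comp i (triv_comp n v) = if i == n then triv_comp n v else 0.
Proof. by case: i n => [|i] [|n] //=; case: ifP. Qed.

Lemma triv_sum v : exists N, v = \sum_(n < N) triv_comp n v.
Proof. by exists 1%N; rewrite big_ord1. Qed.

Definition triv_grading : grading D := Grading triv_orth triv_sum.

Lemma triv_is_dga : is_dga triv_grading (amul D) (aone D) \0.
Proof.
split=> //.
- exact: algebraP.
- split=> // -[|i] [|j] x y //.
  + by rewrite /homog /= => _ <-; rewrite tens0r linear0.
  + by rewrite /homog /= => <- _; rewrite tens0l linear0.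
  + by rewrite /homog /= => <- _; rewrite tens0l linear0.
- by move=> n x y _ /=; rewrite tens0l tens0r !linear0 ?scaler0 addr0.
Qed.

Definition triv_dga : dga k := @Dga k D triv_grading \0 triv_is_dga.

Lemma triv_mor : alg_mor0 (X := triv_dga) (idl D).
Proof. by []. Qed.

Lemma fev_deg0 t :
  exists a, forall i, hcomp (dgr (fdga i)) 0 (fev i t) = fmap i a.
Proof.
elim: t => [a||s [a ha] t [b hb]|c t [a ha]|s [a ha] t [b hb]|t _|[|m] t [a ha]].
- by exists a => i; have [_] := fmapP i; apply.
- by exists 0 => i; rewrite /= !linear0.
- by exists (a + b) => i; rewrite /= !linearD /= ha hb.
- by exists (c *: a) => i; rewrite /= !linearZ /= ha.
- exists (amul D (a \ox b)) => i; rewrite /= dga_mul0 ha hb.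
  by have [[_ ->]] := fmapP i.
- by exists 0 => i; rewrite /= dga_hd linear0.
- by exists a => i; rewrite /= hcomp_orth eqxx ha.
- by exists 0 => i; rewrite /= hcomp_orth linear0.
Qed.

Lemma fgen_mor0 : alg_mor0 (X := forms_dga) fgen.
Proof.
split; last by move=> a; apply/fhomogP => i; rewrite fpev_gen; case: (fmapP i).
split=> // x y; apply: fpev_inj => i.
by rewrite fmultE fpev_mul !fpev_gen; case: (fmapP i) => -[].
Qed.

Theorem universal_forms_exists :
  exists (Om : dga k) (i : {linear D -> Om}), universal_forms i.
Proof.
exists forms_dga, fgen; split.
- exact: fgen_mor0.
- move=> a b /(congr1 (fpev (FObs triv_mor))).
  by rewrite !fpev_gen.
- move=> x hx; have [t et] := fclsP x; have [a ha] := fev_deg0 t.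
  exists a; apply: fpev_inj => i; rewrite fpev_gen -ha -fpev_cls -et.
  by have /fhomogP/(_ i) -> := hx.
- move=> X f hf; pose g : {linear forms_dga -> X} :=
    HB.pack_for {linear forms_dga -> X} (fpev (FObs hf) : forms_dga -> X)
    (GRing.isLinear.Build k forms_dga X _ (fpev (FObs hf) : forms_dga -> X)
       (fpev_linear (FObs hf))).
  exists g; split.
  + split=> [|n v|v]; [split=> [|x y]|..].
    * exact: (fpev_one (FObs hf)).
    * by rewrite -[LHS]/(fpev _ (fmult _)) fmultE fpev_mul.
    * exact: (fpev_comp (FObs hf)).
    * exact: (fpev_diff (FObs hf)).
  + by move=> a; rewrite /= fpev_gen.
  + move=> h [[h1 hM] hc hd] hi u; have [t ->] := fclsP u.
    rewrite -[RHS]/(fpev (FObs hf) (fcls t)) fpev_cls; elim: t => [a||s IHs t IHt|c t IHt|s IHs t IHt|t IHt|n t IHt].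
    * exact: hi.
    * have -> : fcls Fzero = 0 by [].
      exact: linear0.
    * have -> : fcls (Fadd s t) = fcls s + fcls t.
        by apply: fpev_inj => i; rewrite linearD /= !fpev_cls.
      by rewrite linearD /= IHs IHt.
    * have -> : fcls (Fscale c t) = c *: fcls t.
        by apply: fpev_inj => i; rewrite linearZ /= !fpev_cls.
      by rewrite linearZ /= IHt.
    * have -> : fcls (Fmul s t) = amul forms_dga (fcls s \ox fcls t).
        by apply: fpev_inj => i; rewrite fmultE fpev_mul !fpev_cls.
      by rewrite hM IHs IHt.
    * have -> : fcls (Fdiff t) = dd forms_dga (fcls t).
        by apply: fpev_inj => i; rewrite fpev_diff !fpev_cls.
      by rewrite hd IHt.
    * have -> : fcls (Fcomp n t) = hcomp (dgr forms_dga) n (fcls t).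
        by apply: fpev_inj => i; rewrite fpev_comp !fpev_cls.
      by rewrite hc IHt.
Qed.

End Existence.

(* Main.v *)
Require Import Defs.
From HB Require Import structures.
From mathcomp Require Import all_boot all_algebra.

(* Since [R] sends D ⊗ D to D ⊗ D and its extension is compatible with d up to
   the signs ε, the extension sends Ω^p ⊗ Ω^q to Ω^q ⊗ Ω^p; hence [Tt] preserves
   bidegrees.  Therefore the Koszul signs cancel in T13, so that
   T13(τ_gr) = T13(τ), and the signs in the compatibility with d are absorbed by
   τ_gr: [Tt] commutes with d ⊗ Ω and with Ω ⊗ d on the nose.  This gives the
   Leibniz rule for the twisted product.
   The two multiplicativity axioms of a twistor T say exactly that τ_gr ∘ T is
   a twisting map.  The relation T12 T23 = T23 T12 holds on D ⊗ D ⊗ D, is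
   stable under d in each factor, and propagates to products, first in the third
   factor (the other two in D), then in the second (the first in D), and finally
   in the first; elements of D generate Ω under products and d. *)

Set Implicit Arguments.
Unset Strict Implicit.
Unset Printing Implicit Defensive.

Import GRing.Theory.
Local Open Scope ring_scope.

(** * Linearity, induction and bihomogeneous elements in tensor products *)

Section Tensors.
Variable k : fieldType.
Implicit Types U V W X : lmodType k.

HB.instance Definition _ V W (v : V) :=
  GRing.isLinear.Build k W (V ⊗ W) _ (@tens k V W v) (tens_linearr v).

Definition tensl V W (w : W) (v : V) : V ⊗ W := v \ox w.
HB.instance Definition _ V W (w : W) :=
  GRing.isLinear.Build k V (V ⊗ W) _ (@tensl V W w) (tens_linearl w).

Lemma tensDl V W (v v' : V) (w : W) : (v + v') \ox w = v \ox w + v' \ox w.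
Proof. exact: (linearD (tensl w)). Qed.

Lemma tensZl V W a (v : V) (w : W) : (a *: v) \ox w = a *: (v \ox w).
Proof. exact: (linearZ_LR (tensl w)). Qed.

Lemma tensDr V W (v : V) (w w' : W) : v \ox (w + w') = v \ox w + v \ox w'.
Proof. exact: linearD. Qed.

Lemma tensZr V W a (v : V) (w : W) : v \ox (a *: w) = a *: (v \ox w).
Proof. exact: linearZ_LR. Qed.

Lemma tensor_ind V W (P : V ⊗ W -> Prop) :
    P 0 -> (forall t u, P t -> P u -> P (t + u)) ->
    (forall v w, P (v \ox w)) ->
  forall t, P t.
Proof.
move=> P0 PD Pp t; have [s ->] := tensor_span t.
by elim/big_ind: _ => // p _; apply: Pp.
Qed.

Lemma tensor3_eq U V W X (f g : {linear (U ⊗ V) ⊗ W -> X}) :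
  (forall u v w, f ((u \ox v) \ox w) = g ((u \ox v) \ox w)) -> f =1 g.
Proof.
move=> h; apply: tensor_eq => t w; move: t.
by apply: (tensor_eq (f := f \o tensl w) (g := g \o tensl w)) => u v; apply: h.
Qed.

Lemma tensor_heq V W X (G : grading V) (H : grading W)
    (f g : {linear V ⊗ W -> X}) :
  (forall p q v w, homog G p v -> homog H q w -> f (v \ox w) = g (v \ox w)) ->
  f =1 g.
Proof.
move=> h t; have [s [hs ->]] := tensor_hspan G H t.
rewrite !linear_sum !big_seq; apply: eq_bigr => p /hs[].
exact: h.
Qed.

Lemma tensor3_heq U V W X (F : grading U) (G : grading V) (H : grading W)
    (f g : {linear (U ⊗ V) ⊗ W -> X}) :
  (forall p q r u v w, homog F p u -> homog G q v -> homog H r w ->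
    f ((u \ox v) \ox w) = g ((u \ox v) \ox w)) ->
  f =1 g.
Proof.
move=> h; apply: tensor_eq => t w; move: t.
apply: (tensor_heq (G := F) (H := G) (f := f \o tensl w) (g := g \o tensl w)).
move=> p q u v hu hv; rewrite /= /tensl.
rewrite (hbound_sum H w) !linear_sum; apply: eq_bigr => r _.
exact: h hu hv (hcomp_homog _ _ _).
Qed.

(** Membership in V_p ⊗ W_q is stated as being fixed by a projection: a bihomogeneous tensor can
    then be rewritten as its own projection, and [bihomog_ind] follows from plain tensor
    induction. *)
Definition bihomog V W (G : grading V) (H : grading W) p q (t : V ⊗ W) : Prop :=
  tmap (hcomp G p) (hcomp H q) t = t.

Section Bihomog.
Variables (V W : lmodType k) (G : grading V) (H : grading W).
Variables (p q : nat).

Lemma bihomog0 : bihomog G H p q 0.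
Proof. exact: linear0. Qed.

Lemma bihomogD t u :
  bihomog G H p q t -> bihomog G H p q u -> bihomog G H p q (t + u).
Proof. by rewrite /bihomog linearD => -> ->. Qed.

Lemma bihomogZ a t : bihomog G H p q t -> bihomog G H p q (a *: t).
Proof. by rewrite /bihomog linearZ /= => ->. Qed.

Lemma bihomog_tens v w :
  homog G p v -> homog H q w -> bihomog G H p q (v \ox w).
Proof. by rewrite /bihomog tmapE => -> ->. Qed.

Lemma bihomog_ind (P : V ⊗ W -> Prop) :
    P 0 -> (forall t u, P t -> P u -> P (t + u)) ->
    (forall v w, homog G p v -> homog H q w -> P (v \ox w)) ->
  forall t, bihomog G H p q t -> P t.
Proof.
move=> P0 PD Pp t <-; elim/tensor_ind: t => [|t u ht hu|v w].
- by rewrite linear0.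
- by rewrite linearD; apply: PD.
- by rewrite tmapE; apply: Pp; apply: hcomp_homog.
Qed.

End Bihomog.

Lemma tmap_comp V V' V'' W W' W'' (f : {linear V -> V'}) (g : {linear W -> W'})
    (f' : {linear V' -> V''}) (g' : {linear W' -> W''})
    (f'' : {linear V -> V''}) (g'' : {linear W -> W''}) t :
  f' \o f =1 f'' -> g' \o g =1 g'' -> tmap f' g' (tmap f g t) = tmap f'' g'' t.
Proof.
move=> ef eg; move: t; apply: (tensor_eq (f := tmap f' g' \o tmap f g)) => v w.
by rewrite /= !tmapE -ef -eg.
Qed.

Lemma on12E V W (f : {linear V ⊗ V -> W}) x y z :
  on12 f ((x \ox y) \ox z) = f (x \ox y) \ox z.
Proof. exact: tmapE. Qed.

Lemma on23E V (f : {linear V ⊗ V -> V ⊗ V}) x y z :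
  on23 f ((x \ox y) \ox z) = unassoc V V V (x \ox f (y \ox z)).
Proof. by rewrite /on23 /= assocE tmapE. Qed.

Lemma mul23E V (f : {linear V ⊗ V -> V}) x y z :
  mul23 f ((x \ox y) \ox z) = x \ox f (y \ox z).
Proof. by rewrite /mul23 /= assocE tmapE. Qed.

Lemma unassocK U V W : cancel (unassoc U V W) (assoc U V W).
Proof.
apply: (tensor_eq (f := assoc U V W \o unassoc U V W) (g := idl _)) => u.
apply: (tensor_eq (f := assoc U V W \o unassoc U V W \o tens u) (g := tens u)).
by move=> v w; rewrite /= unassocE assocE.
Qed.

Lemma on12_comp V W (f : {linear V ⊗ V -> W}) (g : {linear V ⊗ V -> V ⊗ V}) t :
  on12 (f \o g) t = on12 f (on12 g t).
Proof. by apply/esym/tmap_comp. Qed.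

Lemma on23_comp V (f g : {linear V ⊗ V -> V ⊗ V}) t :
  on23 (f \o g) t = on23 f (on23 g t).
Proof.
by rewrite /on23 /= unassocK; congr (unassoc V V V _); apply/esym/tmap_comp.
Qed.

End Tensors.

Lemma on13E (k : fieldType) (A : algebra k) (c T : {linear A ⊗ A -> A ⊗ A}) t :
  on13 c T t = on23 c (on12 T (on23 c t)).
Proof. by []. Qed.

(* Otherwise [/=] unfolds these compositions and the lemmas above stop matching. *)
#[local] Opaque on12 on23 mul23 on13.

(** The maps [c \o (c \o Rt)] and [Rt] are only known to agree pointwise, so the property has to be
    transported along [=1]. *)
Lemma eq_is_twisting (k : fieldType) (A : algebra k)
    (f g : {linear A ⊗ A -> A ⊗ A}) :
  f =1 g -> is_twisting f -> is_twisting g.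
Proof.
move=> e.
have e12 : on12 f =1 on12 g by apply: tensor3_eq => x y z; rewrite !on12E e.
have e23 : on23 f =1 on23 g by apply: tensor3_eq => x y z; rewrite !on23E e.
case=> h1 h2 h3 h4; split=> t; rewrite /= -?e -?e12 -?e23 -?e12.
- exact: h1.
- exact: h2.
- exact: h3.
- exact: h4.
Qed.

(** * Twisting maps and the multiplicativity axioms of twistors *)

Section Twisting.
Variables (k : fieldType) (A : algebra k) (c T : {linear A ⊗ A -> A ⊗ A}).
Hypotheses (c_tw : is_twisting c) (cK : cancel c c).
Hypothesis c_nat : on13 c T =1 on12 c \o on23 T \o on12 c.
Local Notation m := (amul A).
Local Notation e := (aone A).

Lemma on12K : cancel (on12 c) (on12 c).
Proof.
move=> t; rewrite -on12_comp; move: t.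
apply: (tensor3_eq (f := on12 (c \o c)) (g := idl _)) => x y z.
by rewrite on12E /= cK.
Qed.

Lemma on23K : cancel (on23 c) (on23 c).
Proof.
move=> t; rewrite -on23_comp; move: t.
apply: (tensor3_eq (f := on23 (c \o c)) (g := idl _)) => x y z.
by rewrite on23E /= cK unassocE.
Qed.

(** As c is itself a twisting map, it passes through the product and becomes a composite of c12 and
    c23. Writing T13 as a conjugate by c12 in one axiom and by c23 in the other, one pair of c's
    cancels, and what remains is the corresponding axiom for c ∘ T. *)
Lemma twisting_iff : is_twisting (c \o T) <->
  [/\ forall x, T (e \ox x) = e \ox x,
      forall x, T (x \ox e) = x \ox e,
      mul23 m \o on13 c T \o on12 T =1 T \o mul23 m
    & on12 m \o on13 c T \o on23 T =1 T \o on12 m].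
Proof.
have [c1r c1l c23 c12] := c_tw; have cI := can_inj cK.
have h1 t : c (mul23 m (on13 c T (on12 T t))) =
    on12 m (on23 (c \o T) (on12 (c \o T) t)).
  rewrite -[LHS]/((c \o mul23 m) _) c23 c_nat /= on12K.
  by rewrite on23_comp on12_comp.
have h2 t : c (on12 m (on13 c T (on23 T t))) =
    mul23 m (on12 (c \o T) (on23 (c \o T) t)).
  rewrite -[LHS]/((c \o on12 m) _) c12 /= on13E on23K.
  by rewrite on23_comp on12_comp.
split=> -[p1 p2 p3 p4]; split=> t.
- by apply: cI; rewrite c1l; apply: p2.
- by apply: cI; rewrite c1r; apply: p1.
- by apply: cI; rewrite /= h1; apply/esym/p3.
- by apply: cI; rewrite /= h2; apply/esym/p4.
- by rewrite /= p2 c1r.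
- by rewrite /= p1 c1l.
- by rewrite /= -h1; congr (c _); apply/esym/p3.
- by rewrite /= -h2; congr (c _); apply/esym/p4.
Qed.

End Twisting.

(** * The flip and the graded flip as braidings *)

Section Insertion.
Variables (k : fieldType) (V : lmodType k).

(** T13(τ) sends x ⊗ y ⊗ z to [insert2 y (T (x \ox z))]: the middle factor is carried along
    untouched. *)
Definition insert2 (y : V) : {linear V ⊗ V -> (V ⊗ V) ⊗ V} :=
  tmap (tensl y) (idl V).

Lemma insert2E x y z : insert2 y (x \ox z) = (x \ox y) \ox z.
Proof. exact: tmapE. Qed.

Lemma flip12 y t : on12 (flip V V) (unassoc V V V (y \ox t)) = insert2 y t.
Proof.
move: t; apply: (tensor_eq (f := on12 (flip V V) \o unassoc V V V \o tens y)).
by move=> u v; rewrite /= unassocE on12E flipE insert2E.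
Qed.

Lemma flip23 y t : on23 (flip V V) (t \ox y) = insert2 y t.
Proof.
move: t; apply: (tensor_eq (f := on23 (flip V V) \o tensl y)).
by move=> u v; rewrite /= /tensl on23E flipE unassocE insert2E.
Qed.

End Insertion.

Section Flip.
Variables (k : fieldType) (A : algebra k).
Local Notation flipA := (flip A A).

Lemma flipK : cancel flipA flipA.
Proof.
apply: (tensor_eq (f := flipA \o flipA) (g := idl _)) => u v.
by rewrite /= !flipE.
Qed.

Lemma flip_twisting : is_twisting flipA.
Proof.
split=> [a|a||]; rewrite ?flipE //; apply: tensor3_eq => x y z /=.
- rewrite mul23E on12E !flipE on23E flipE unassocE.
  by rewrite on12E.
- rewrite !on12E !flipE on23E flipE unassocE.
  by rewrite on12E flipE mul23E.
Qed.

Lemma on13_flipE (T : {linear A ⊗ A -> A ⊗ A}) x y z :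
  on13 flipA T ((x \ox y) \ox z) = insert2 y (T (x \ox z)).
Proof. by rewrite on13E flip23 insert2E on12E flip23. Qed.

Lemma flip_nat (T : {linear A ⊗ A -> A ⊗ A}) :
  on13 flipA T =1 on12 flipA \o on23 T \o on12 flipA.
Proof.
apply: tensor3_eq => x y z.
by rewrite on13_flipE /= on12E flipE on23E flip12.
Qed.

End Flip.

Section GradedFlip.
Variables (k : fieldType) (A : dga k).
Local Notation G := (dgr A).
Local Notation c := (gflip G G).

Lemma gflipK : cancel c c.
Proof.
apply: (tensor_heq (G := G) (H := G) (f := c \o c) (g := idl _)).
move=> p q v w hv hw /=; rewrite (gflipE hv hw) linearZ /= (gflipE hw hv).
by rewrite scalerA mulnC -expr2 sqrr_sign scale1r.
Qed.

Lemma gflip1l x : c (aone A \ox x) = x \ox aone A.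
Proof.
rewrite (hbound_sum G x) tens_suml linear_sum linear_sum.
apply: eq_bigr => p _.
by rewrite (gflipE (dga_one A) (hcomp_homog _ _ _)) mul0n scale1r.
Qed.

Lemma gflip1r x : c (x \ox aone A) = aone A \ox x.
Proof. by rewrite -gflip1l gflipK. Qed.

Lemma gflip_bihomog p q t :
  bihomog G G p q t -> c t = (-1) ^+ (p * q) *: flip A A t.
Proof.
elim/bihomog_ind => [|u v eu ev|v w hv hw]; first by rewrite !linear0.
  by rewrite !linearD eu ev.
by rewrite (gflipE hv hw) flipE.
Qed.

Lemma gflip12 p q r y t : homog G p y -> bihomog G G q r t ->
  on12 c (unassoc A A A (y \ox t)) = (-1) ^+ (p * q) *: insert2 y t.
Proof.
move=> hy; elim/bihomog_ind => [|u v eu ev|u v hu hv].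
- by rewrite !linear0.
- by rewrite !linearD eu ev.
- by rewrite unassocE on12E (gflipE hy hu) tensZl insert2E.
Qed.

Lemma gflip23 p q r y t : homog G r y -> bihomog G G p q t ->
  on23 c (t \ox y) = (-1) ^+ (q * r) *: insert2 y t.
Proof.
move=> hy; elim/bihomog_ind => [|u v eu ev|u v hu hv].
- by rewrite tens0l !linear0.
- by rewrite tensDl !linearD eu ev.
- by rewrite on23E (gflipE hv hy) tensZr !linearZ /= unassocE insert2E.
Qed.

Lemma gflip_twisting : is_twisting c.
Proof.
split; [exact: gflip1r|exact: gflip1l|..];
  apply: (tensor3_heq (F := G) (G := G) (H := G)) => p q r x y z hx hy hz /=.
- rewrite mul23E (gflipE hx (dga_mul hy hz)) on12E (gflipE hx hy).
  rewrite tensZl linearZ /= on23E (gflipE hx hz) tensZr !linearZ /= unassocE.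
  by rewrite !linearZ /= on12E scalerA -exprD addnC mulnDr.
- rewrite on12E (gflipE (dga_mul hx hy) hz) on23E (gflipE hy hz).
  rewrite tensZr !linearZ /= unassocE on12E (gflipE hx hz).
  by rewrite tensZl linearZ /= mul23E scalerA -exprD mulnDl addnC.
Qed.

Section Bigraded.
Variable T : {linear A ⊗ A -> A ⊗ A}.
Hypothesis T_bi : forall p q x y,
  homog G p x -> homog G q y -> bihomog G G p q (T (x \ox y)).

(* The signs cancel because T preserves the bidegree. *)
Lemma on13_gflip : on13 c T =1 on13 (flip A A) T.
Proof.
apply: (tensor3_heq (F := G) (G := G) (H := G)) => p q r x y z hx hy hz.
rewrite on13_flipE on13E (gflip23 hz (bihomog_tens hx hy)) !linearZ /=.
rewrite insert2E on12E (gflip23 hy (T_bi hx hz)) scalerA mulnC.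
by rewrite -expr2 sqrr_sign scale1r.
Qed.

(** The factor y passes x, and later the first components of T(x ⊗ z); these have the degree of x,
    so the same sign occurs twice. *)
Lemma gflip_nat : on13 c T =1 on12 c \o on23 T \o on12 c.
Proof.
apply: (tensor3_heq (F := G) (G := G) (H := G)) => p q r x y z hx hy hz.
rewrite on13_gflip on13_flipE /= on12E (gflipE hx hy) tensZl !linearZ /=.
rewrite on23E (gflip12 hy (T_bi hx hz)) scalerA mulnC.
by rewrite -expr2 sqrr_sign scale1r.
Qed.

End Bigraded.

End GradedFlip.

(** * Bidegrees under products and under maps of the factors *)

Section Bidegrees.
Variables (k : fieldType) (A : dga k).
Local Notation G := (dgr A).
Local Notation m := (amul A).
Local Notation d := (dd A).

Lemma homogZ n a (x : A) : homog G n x -> homog G n (a *: x).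
Proof. by rewrite /homog linearZ /= => ->. Qed.

Lemma homog_gsign n (x : A) : homog G n x -> homog G n (gsign G x).
Proof. by move=> hx; rewrite (gsignE hx); apply: homogZ. Qed.

Lemma hcomp_amul n x y : hcomp G n (m (x \ox y)) =
  \sum_(j < n.+1) m (hcomp G j x \ox hcomp G (n - j)%N y).
Proof.
transitivity (m (hcomp (tgrading G G) n (x \ox y))); last first.
  by rewrite /= /tcomp linear_sum; apply: eq_bigr => j _; rewrite tmapE.
move: (x \ox y).
apply: (tensor_heq (G := G) (H := G) (f := hcomp G n \o m)
  (g := m \o hcomp (tgrading G G) n)) => p q u v hu hv /=.
rewrite (homog_hcomp _ (dga_mul hu hv)) (tcomp_homog _ hu hv).
by case: ifP; rewrite ?linear0.
Qed.

Lemma bihomog_tmap (f g : {linear A -> A}) p q p' q' t :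
    (forall x, homog G p x -> homog G p' (f x)) ->
    (forall x, homog G q x -> homog G q' (g x)) ->
  bihomog G G p q t -> bihomog G G p' q' (tmap f g t).
Proof.
move=> hf hg; elim/bihomog_ind => [|u v hu hv|u v hu hv].
- by rewrite linear0; apply: bihomog0.
- by rewrite linearD; apply: bihomogD.
- by rewrite tmapE; apply: bihomog_tens; [apply: hf|apply: hg].
Qed.

Lemma bihomog_flip p q t :
  bihomog G G p q t -> bihomog G G q p (flip A A t).
Proof.
elim/bihomog_ind => [|u v hu hv|u v hu hv].
- by rewrite linear0; apply: bihomog0.
- by rewrite linearD; apply: bihomogD.
- by rewrite flipE; apply: bihomog_tens.
Qed.

Lemma bihomog_mul12 p q r x t : homog G p x -> bihomog G G q r t ->
  bihomog G G (p + q)%N r (on12 m (unassoc A A A (x \ox t))).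
Proof.
move=> hx; elim/bihomog_ind => [|u v hu hv|u v hu hv].
- by rewrite !linear0; apply: bihomog0.
- by rewrite !linearD; apply: bihomogD.
- rewrite unassocE on12E; apply: bihomog_tens => //; exact: dga_mul.
Qed.

Lemma bihomog_mul23 p q r x t : homog G r x -> bihomog G G p q t ->
  bihomog G G p (q + r)%N (mul23 m (t \ox x)).
Proof.
move=> hx; elim/bihomog_ind => [|u v hu hv|u v hu hv].
- by rewrite tens0l !linear0; apply: bihomog0.
- by rewrite tensDl !linearD; apply: bihomogD.
- rewrite mul23E; apply: bihomog_tens => //; exact: dga_mul.
Qed.

(** Meant for p = 0: the first factors then come from D, as the propagation of T12 T23 = T23 T12 to
    products requires. *)
Lemma bihomog_span p q t : bihomog G G p q t ->
  exists2 s : seq (A * A), t = \sum_(r <- s) r.1 \ox r.2 &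
    forall r, r \in s -> homog G p r.1.
Proof.
elim/bihomog_ind => [|u v [s -> hs] [r -> hr]|u v hu hv].
- by exists [::]; rewrite ?big_nil.
- exists (s ++ r); first by rewrite big_cat.
  by move=> x; rewrite mem_cat => /orP[/hs|/hr].
- exists [:: (u, v)]; first by rewrite big_seq1.
  by move=> x; rewrite inE => /eqP ->.
Qed.

End Bidegrees.

(** * Generation of Ω by D, products and d *)

Section Generation.
Variables (k : fieldType) (D : algebra k) (Om : dga k) (i : {linear D -> Om}).
Hypothesis U : universal_forms i.
Local Notation G := (dgr Om).

(* The DGA morphism from Om to the forms built from expressions, followed by
   evaluation in Om, is the identity by uniqueness. *)
Lemma universal_expr (hi : alg_mor0 i) (x : Om) :
  exists t : fexpr D, x = fev (FObs hi) t.
Proof.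
have [_ _ _ un] := U; pose ob := FObs hi.
have [g [[[g1 gM] gc gd] gi _]] := un _ _ (fgen_mor0 D).
have lin : linear (fun u => fpev ob (g u)) by move=> a u v; rewrite !linearP.
pose h : {linear Om -> Om} := HB.pack_for {linear Om -> Om}
  (fun u => fpev ob (g u)) (GRing.isLinear.Build k Om Om _ _ lin).
have hE u : h u = fpev ob (g u) by [].
have [f [_ _ uf]] := un _ _ hi.
have -> : x = h x.
  transitivity (f x).
    by apply: (uf (idl Om)) => //; split.
  apply/esym/uf => [|a]; last first.
    by rewrite -[LHS]/(fpev ob ((g \o i) a)) gi fpev_gen.
  split=> [|n u|u]; [split=> [|u v]|..]; rewrite !hE.
  - by rewrite g1; apply: (fpev_one ob).
  - by rewrite gM [amul _ _](fmultE (g u) (g v)) (fpev_mul ob).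
  - by rewrite gc; apply: (fpev_comp ob).
  - by rewrite gd; apply: (fpev_diff ob).
have [t et] := fclsP (g x).
by exists t; rewrite hE et fpev_cls.
Qed.

(** A homogeneous x is its own component of degree n, so the claim is proved for all components of
    the value of an expression, by induction on the expression. All degrees are needed at once,
    since a component of a product is a sum of products of components. *)
Lemma universal_ind (P : nat -> Om -> Prop) :
    (forall n, P n 0) -> (forall n x y, P n x -> P n y -> P n (x + y)) ->
    (forall n a x, P n x -> P n (a *: x)) ->
    (forall a, P 0%N (i a)) ->
    (forall n x, homog G n x -> P n x -> P n.+1 (dd Om x)) ->
    (forall p q x y, homog G p x -> homog G q y -> P p x -> P q y ->
      P (p + q)%N (amul Om (x \ox y))) ->
  forall n x, homog G n x -> P n x.
Proof.
move=> P0 PD PZ Pi Pd PM n x <-; have [hi _ _ _] := U.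
have [t ->] := universal_expr hi x.
elim: t n {x} => [a||s IHs t IHt|a t IHt|s IHs t IHt|t IHt|j t IHt] n /=.
- by have [_ h] := hi; rewrite (homog_hcomp _ (h a)); case: eqP => [->|].
- by rewrite linear0.
- by rewrite linearD; apply: PD.
- by rewrite linearZ; apply: PZ.
- rewrite hcomp_amul; elim/big_ind: _ => // [x y|j _]; first exact: PD.
  have jn : (j <= n)%N by rewrite -ltnS.
  have := PM _ _ _ _ (hcomp_homog G j _) (hcomp_homog G (n - j)%N _) (IHs j)
    (IHt (n - j)%N).
  by rewrite subnKC.
- rewrite dga_hd; case: n => // n; apply: Pd => //; exact: hcomp_homog.
- by rewrite hcomp_orth; case: eqP => [->|].
Qed.

End Generation.

(** * Bidegrees of the extension and its compatibility with d *)

Section Extension.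
Variables (k : fieldType) (D : algebra k) (Om : dga k) (i : {linear D -> Om}).
Variables (R : {linear D ⊗ D -> D ⊗ D}) (Rt : {linear Om ⊗ Om -> Om ⊗ Om}).
Hypotheses (U : universal_forms i) (E : is_extension i R Rt).
Local Notation G := (dgr Om).
Local Notation m := (amul Om).
Local Notation d := (dd Om).
Local Notation c := (gflip G G).
Local Notation bihomogO := (bihomog G G).

Lemma extension_gen a b : Rt (i a \ox i b) = tmap i i (R (a \ox b)).
Proof. by have [_ h _ _] := E; rewrite -tmapE; apply: h. Qed.

Lemma extension_dl t : Rt (tmap d (idl Om) t) = tmap (gsign G) d (Rt t).
Proof. by have [_ _ h _] := E; apply: h. Qed.

Lemma extension_dr t : Rt (tmap (idl Om) d t) = tmap d (gsign G) (Rt t).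
Proof. by have [_ _ _ h] := E; apply: h. Qed.

Lemma gen_homog a : homog G 0 (i a).
Proof. by have [[_ h] _ _ _] := U; apply: h. Qed.

Lemma homog0_gen x : homog G 0 x -> exists a, x = i a.
Proof. by have [_ _ h _] := U; apply: h. Qed.

Lemma tmap_gen_bihomog t : bihomogO 0 0 (tmap i i t).
Proof.
elim/tensor_ind: t => [|t u|a b].
- by rewrite linear0; apply: bihomog0.
- by rewrite linearD; apply: bihomogD.
- by rewrite tmapE; apply: bihomog_tens; apply: gen_homog.
Qed.

(** Induction on y, for all a at once. For a product xy, the second components of R̃(a ⊗ x) have
    degree 0, hence lie in D, and the induction hypothesis for y applies to them. *)
Lemma extension_bihomog0 q y a : homog G q y -> bihomogO q 0 (Rt (i a \ox y)).
Proof.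
have [[_ _ mulr _] _ _ _] := E.
move=> hy; move: q y hy a.
apply: (universal_ind U) => [n a|n x y hx hy a|n b x hx a|b a|n x hx h a|].
- by rewrite tens0r !linear0; apply: bihomog0.
- by rewrite tensDr !linearD; apply: bihomogD.
- by rewrite tensZr !linearZ; apply: bihomogZ.
- by rewrite extension_gen; apply: tmap_gen_bihomog.
- have := extension_dr (i a \ox x); rewrite tmapE => ->.
  by apply: bihomog_tmap (h a) => u hu; [apply: dga_d|apply: homog_gsign].
move=> p q x y hx hy IHx IHy a.
have := mulr ((i a \ox x) \ox y); rewrite /= mul23E on12E => ->.
elim/bihomog_ind: (IHx a) => [|u v hu hv|u v hu /homog0_gen[b ->]].
- by rewrite tens0l !linear0; apply: bihomog0.
- by rewrite tensDl !linearD; apply: bihomogD.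
- by rewrite on23E; apply: bihomog_mul12.
Qed.

(** Induction on x, the case of D being [extension_bihomog0]. The second argument stays general
    because, for a product xy, x meets the first components of R̃(y ⊗ z). *)
Lemma extension_bihomog p q x y :
  homog G p x -> homog G q y -> bihomogO q p (Rt (x \ox y)).
Proof.
have [[_ _ _ mull] _ _ _] := E.
move=> hx; move: p x hx q y.
apply: (universal_ind U) =>
  [n q z _|n x y hx hy q z hz|n b x hx q z hz|a q z hz|n x hx h q z hz|].
- by rewrite tens0l !linear0; apply: bihomog0.
- by rewrite tensDl !linearD; apply: bihomogD; [apply: hx|apply: hy].
- by rewrite tensZl !linearZ; apply: bihomogZ; apply: hx.
- exact: extension_bihomog0.
- have := extension_dl (x \ox z); rewrite tmapE => ->.
  by apply: bihomog_tmap (h _ _ hz) => u hu; [apply: homog_gsign|apply: dga_d].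
move=> p q x y hx hy IHx IHy r z hz.
have := mull ((x \ox y) \ox z); rewrite /= on12E on23E => ->.
elim/bihomog_ind: (IHy r z hz) => [|u v hu hv|u v hu hv].
- by rewrite !linear0; apply: bihomog0.
- by rewrite !linearD; apply: bihomogD.
- by rewrite unassocE on12E; apply: bihomog_mul23 => //; apply: IHx.
Qed.

(** For x of degree p, ε gives (-1)^p, and raising the degree of the second factor adds p to the
    exponent of the Koszul sign; the two cancel. *)
Lemma gflip_dr t : c (tmap (gsign G) d t) = tmap d (idl Om) (c t).
Proof.
move: t; apply: (tensor_heq (G := G) (H := G) (f := c \o tmap (gsign G) d)
  (g := tmap d (idl Om) \o c)) => p q x y hx hy /=.
rewrite tmapE (gflipE hx hy) linearZ /= tmapE (gsignE hx) tensZl linearZ /=.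
rewrite (gflipE hx (dga_d hy)) scalerA -exprD mulnS addnA addnn.
by rewrite -(signr_odd _ (_ + _)) oddD odd_double signr_odd.
Qed.

Lemma gflip_dl t : c (tmap d (gsign G) t) = tmap (idl Om) d (c t).
Proof.
apply: (can_inj (@gflipK _ Om)); rewrite gflipK.
apply/esym; move: t.
apply: (tensor_heq (G := G) (H := G) (f := c \o (tmap (idl Om) d \o c))
  (g := tmap d (gsign G))) => p q x y hx hy /=.
rewrite (gflipE hx hy) !linearZ /= !tmapE /=.
rewrite (gflipE hy (dga_d hx)) (gsignE hy).
rewrite tensZr scalerA -exprD mulnC mulnS addnCA addnn.
by rewrite -(signr_odd _ (_ + _)) oddD odd_double addbF signr_odd.
Qed.

Local Notation T := (c \o Rt : {linear Om ⊗ Om -> Om ⊗ Om}).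

Lemma twisted_bihomog p q x y :
  homog G p x -> homog G q y -> bihomogO p q (T (x \ox y)).
Proof.
move=> hx hy /=; have h := extension_bihomog hx hy.
by rewrite (gflip_bihomog h); apply/bihomogZ/bihomog_flip.
Qed.

(** On a bihomogeneous tensor the projections of the total grading are the identity or zero, so
    preserving bidegrees suffices. *)
Lemma twisted_graded : graded_map (tgrading G G) (tgrading G G) T.
Proof.
move=> n; apply: (tensor_heq (G := G) (H := G) (f := T \o tcomp G G n)
  (g := tcomp G G n \o T)) => p q x y hx hy.
have h := twisted_bihomog hx hy; rewrite -[LHS]/(T (tcomp G G n _)).
rewrite -[RHS]/(tcomp G G n (T _)) (tcomp_homog _ hx hy).
transitivity (if n == (p + q)%N then T (x \ox y) else 0).
  by case: ifP => _ //; rewrite linear0.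
elim/bihomog_ind: h => [|u v hu hv|u v hu hv].
- by rewrite linear0 if_same.
- by rewrite linearD /= -hu -hv; case: ifP => _; rewrite ?addr0.
- by rewrite (tcomp_homog _ hu hv).
Qed.

Lemma twisted_gen a b : T (i a \ox i b) = tmap i i ((flip D D \o R) (a \ox b)).
Proof.
(* In bidegree (0, 0) the graded flip is the flip, without sign. *)
rewrite /= extension_gen (gflip_bihomog (tmap_gen_bihomog _)) scale1r.
move: (R _); apply: (tensor_eq (f := flip Om Om \o tmap i i)
  (g := tmap i i \o flip D D)) => u v.
by rewrite /= tmapE !flipE tmapE.
Qed.

Lemma twisted_dl t : T (tmap d (idl Om) t) = tmap d (idl Om) (T t).
Proof. by rewrite /= extension_dl gflip_dr. Qed.

Lemma twisted_dr t : T (tmap (idl Om) d t) = tmap (idl Om) d (T t).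
Proof. by rewrite /= extension_dr gflip_dl. Qed.

End Extension.

(** * Operators on three tensor factors *)

Section ThreeFold.
Variables (k : fieldType) (V : lmodType k).
Implicit Types (f : {linear V -> V}) (g : {linear V ⊗ V -> V ⊗ V}).

Lemma on12_tmapl f x t :
  on12 (tmap f (idl V)) (unassoc V V V (x \ox t)) = unassoc V V V (f x \ox t).
Proof.
elim/tensor_ind: t => [|t u ht hu|y z]; first by rewrite !tens0r !linear0.
  by rewrite !tensDr !linearD ht hu.
by rewrite !unassocE on12E tmapE.
Qed.

Lemma tmapr_unassoc f x t : tmap (idl (V ⊗ V)) f (unassoc V V V (x \ox t)) =
  unassoc V V V (x \ox tmap (idl V) f t).
Proof.
elim/tensor_ind: t => [|t u ht hu|y z]; first by rewrite !(linear0, tens0r).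
  by rewrite !(tensDr, linearD) ht hu.
by rewrite unassocE !tmapE unassocE.
Qed.

Lemma on12_tens (W : lmodType k) (g : {linear V ⊗ V -> W}) t z :
  on12 g (t \ox z) = g t \ox z.
Proof.
elim/tensor_ind: t => [|t u ht hu|x y]; first by rewrite !(linear0, tens0l).
  by rewrite !(tensDl, linearD) ht hu.
by rewrite on12E.
Qed.

Lemma on23_unassoc g x t :
  on23 g (unassoc V V V (x \ox t)) = unassoc V V V (x \ox g t).
Proof.
elim/tensor_ind: t => [|t u ht hu|y z]; first by rewrite !(linear0, tens0r).
  by rewrite !(tensDr, linearD) ht hu.
by rewrite unassocE on23E.
Qed.

(** Both sides apply f to the middle factor, which T12 and T23 share. *)
Lemma on12_tmapr f t : on12 (tmap (idl V) f) t = on23 (tmap f (idl V)) t.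
Proof.
by move: t; apply: tensor3_eq => x y z; rewrite on12E on23E !tmapE unassocE.
Qed.

End ThreeFold.

(** * Propagation of T12 T23 = T23 T12 to products and differentials *)

Section Commutation.
Variables (k : fieldType) (A : algebra k) (T : {linear A ⊗ A -> A ⊗ A}).
Local Notation m := (amul A).
Local Notation un := (unassoc A A A).
Hypothesis T_mulr :
  mul23 m \o on13 (flip A A) T \o on12 T =1 T \o mul23 m.
Hypothesis T_mull :
  on12 m \o on13 (flip A A) T \o on23 T =1 T \o on12 m.

Definition lmul x : {linear A -> A} := m \o tens x.
Definition rmul x : {linear A -> A} := m \o tensl x.

(** The multiplicativity axioms in operator form: multiplying the first argument of T by x on the
    left applies [twl x] to the value ([mul_twl]), and multiplying the second by y on the right
    applies [twr y] ([mul_twr]). *)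
Definition twl x : {linear A ⊗ A -> A ⊗ A} :=
  on12 m \o on13 (flip A A) T \o un \o tens x.
Definition twr y : {linear A ⊗ A -> A ⊗ A} :=
  mul23 m \o on13 (flip A A) T \o tensl y.

Lemma mul_twl x x' y : T (m (x \ox x') \ox y) = twl x (T (x' \ox y)).
Proof. by have := T_mull ((x \ox x') \ox y); rewrite /= on12E on23E. Qed.

Lemma mul_twr x y y' : T (x \ox m (y \ox y')) = twr y' (T (x \ox y)).
Proof. by have := T_mulr ((x \ox y) \ox y'); rewrite /= on12E mul23E. Qed.

Lemma twlE x x' y : twl x (x' \ox y) = tmap (rmul x') (idl A) (T (x \ox y)).
Proof.
rewrite /= unassocE on13_flipE.
elim/tensor_ind: (T _) => [|t u ht hu|u v]; first by rewrite !linear0.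
  by rewrite !linearD ht hu.
by rewrite insert2E on12E tmapE.
Qed.

Lemma twrE x y y' : twr y' (x \ox y) = tmap (idl A) (lmul y) (T (x \ox y')).
Proof.
rewrite /= /tensl on13_flipE.
elim/tensor_ind: (T _) => [|t u ht hu|u v]; first by rewrite !linear0.
  by rewrite !linearD ht hu.
by rewrite insert2E mul23E tmapE.
Qed.

#[local] Opaque twl twr.

Definition commute_at w := on12 T (on23 T w) = on23 T (on12 T w).
Definition commute3 x y z := commute_at ((x \ox y) \ox z).

Lemma commute_at0 : commute_at 0.
Proof. by rewrite /commute_at !linear0. Qed.

Lemma commute_atD t u : commute_at t -> commute_at u -> commute_at (t + u).
Proof. by rewrite /commute_at !linearD => -> ->. Qed.

Lemma commute_atZ a t : commute_at t -> commute_at (a *: t).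
Proof. by rewrite /commute_at !linearZ /= => ->. Qed.

Lemma commute3E x y z : commute3 x y z <->
  on12 T (un (x \ox T (y \ox z))) = on23 T (T (x \ox y) \ox z).
Proof. by rewrite /commute3 /commute_at on23E on12E. Qed.

(** From here to [on23_twrE], multiplications and maps of a single factor are moved through T12 and
    T23; each rule reduces to simple tensors. *)
Lemma on12_twl x x' t :
  on12 T (un (m (x \ox x') \ox t)) = on12 (twl x) (on12 T (un (x' \ox t))).
Proof.
elim/tensor_ind: t => [|t u ht hu|y z].
- by rewrite !(tens0r, linear0).
- by rewrite !(tensDr, linearD) ht hu.
- by rewrite !unassocE !on12_tens mul_twl.
Qed.

Lemma on12_twr x y t : on12 T (un (x \ox tmap (rmul y) (idl A) t)) =
  on12 (twr y) (on12 T (un (x \ox t))).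
Proof.
elim/tensor_ind: t => [|t u ht hu|u v].
- by rewrite !(tens0r, linear0).
- by rewrite !(tensDr, linearD) ht hu.
- by rewrite tmapE !unassocE !on12_tens -mul_twr.
Qed.

Lemma on23_twl y t z : on23 T (tmap (idl A) (lmul y) t \ox z) =
  on23 (twl y) (on23 T (t \ox z)).
Proof.
elim/tensor_ind: t => [|t u ht hu|u v].
- by rewrite !(tens0l, linear0).
- by rewrite !(tensDl, linearD) ht hu.
- by rewrite tmapE !on23E on23_unassoc -mul_twl.
Qed.

Lemma on23_twr t z z' :
  on23 T (t \ox m (z \ox z')) = on23 (twr z') (on23 T (t \ox z)).
Proof.
elim/tensor_ind: t => [|t u ht hu|u v].
- by rewrite !(tens0l, linear0).
- by rewrite !(tensDl, linearD) ht hu.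
- by rewrite !on23E on23_unassoc -mul_twr.
Qed.

Lemma on23_tmapl f t z : on23 T (tmap f (idl A) t \ox z) =
  on12 (tmap f (idl A)) (on23 T (t \ox z)).
Proof.
elim/tensor_ind: t => [|t u ht hu|u v].
- by rewrite !(tens0l, linear0).
- by rewrite !(tensDl, linearD) ht hu.
- by rewrite tmapE !on23E on12_tmapl.
Qed.

Lemma on12_twlE x u t : on12 (twl x) (un (u \ox t)) =
  on12 (tmap (rmul u) (idl A)) (on12 T (un (x \ox t))).
Proof.
elim/tensor_ind: t => [|t t' ht ht'|y z].
- by rewrite !(tens0r, linear0).
- by rewrite !(tensDr, linearD) ht ht'.
- by rewrite !unassocE !on12_tens twlE.
Qed.

Lemma on12_tmapr_id f x t : on12 T (un (x \ox tmap (idl A) f t)) =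
  tmap (idl (A ⊗ A)) f (on12 T (un (x \ox t))).
Proof.
elim/tensor_ind: t => [|t u ht hu|y z].
- by rewrite !(tens0r, linear0).
- by rewrite !(tensDr, linearD) ht hu.
- by rewrite tmapE !unassocE !on12_tens tmapE.
Qed.

Lemma on23_twrE t w z : on23 (twr z) (t \ox w) =
  tmap (idl (A ⊗ A)) (lmul w) (on23 T (t \ox z)).
Proof.
elim/tensor_ind: t => [|t u ht hu|x y].
- by rewrite !(tens0l, linear0).
- by rewrite !(tensDl, linearD) ht hu.
- by rewrite !on23E twrE tmapr_unassoc.
Qed.

(** Once x is extracted by [twl x] and the relation for x' is applied, x meets the second components
    v of T(x' ⊗ y), which are arbitrary; hence the quantification over v. *)
Lemma commute3_mull x x' y z : commute3 x' y z ->
  (forall v, commute3 x v z) -> commute3 (m (x \ox x')) y z.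
Proof.
move=> /commute3E h' h; apply/commute3E; rewrite on12_twl h' mul_twl.
elim/tensor_ind: (T (x' \ox y)) => [|t u ht hu|u v].
- by rewrite !(tens0l, linear0).
- by rewrite !(tensDl, linearD) ht hu.
have /commute3E hv := h v.
by rewrite on23E on12_twlE hv twlE on23_tmapl.
Qed.

(** After z is dealt with, z' meets the first components of T(y ⊗ z). The decomposition [s] is left
    free so that these components can be chosen in D. *)
Lemma commute3_mulr x y z z' s : commute3 x y z ->
  T (y \ox z) = \sum_(p <- s) p.1 \ox p.2 ->
  (forall p, p \in s -> commute3 x p.1 z') -> commute3 x y (m (z \ox z')).
Proof.
move=> /commute3E h es hs; apply/commute3E.
rewrite on23_twr -h mul_twr es !(linear_sum, tens_sumr) !big_seq /=.
apply: eq_bigr => p /hs/commute3E hp.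
rewrite twrE on12_tmapr_id hp unassocE on12_tens.
by rewrite on23_twrE.
Qed.

Lemma on12_twrE x u s t : T (x \ox u) = \sum_(p <- s) p.1 \ox p.2 ->
  on12 (twr u) (un (x \ox t)) =
  \sum_(p <- s) un (p.1 \ox tmap (rmul p.2) (idl A) t).
Proof.
move=> es; elim/tensor_ind: t => [|t t' ht ht'|y z].
- by rewrite !(tens0r, linear0) big1 // => p _; rewrite !(tens0r, linear0).
- rewrite !(tensDr, linearD) ht ht' -big_split; apply: eq_bigr => p _.
  by rewrite !(tensDr, linearD).
rewrite unassocE on12_tens twrE es !(linear_sum, tens_suml).
by apply: eq_bigr => p _; rewrite !tmapE unassocE.
Qed.

(** Both sides multiply, in the middle factor, the first components of T(y ⊗ w) on the right by the
    second components of T(x ⊗ u). *)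
Lemma twr_twl x u y w : on12 (twr u) (un (x \ox T (y \ox w))) =
  on23 (twl y) (T (x \ox u) \ox w).
Proof.
have [s es] := tensor_span (T (x \ox u)).
rewrite (on12_twrE _ es) es !(tens_suml, linear_sum).
by apply: eq_bigr => p _; rewrite on23E twlE.
Qed.

(** The relation for y is needed at the second components w of T(y' ⊗ z), and the one for y' at the
    first components of T(x ⊗ y), again chosen freely. *)
Lemma commute3_mulm x y y' z s : (forall w, commute3 x y w) ->
  T (x \ox y) = \sum_(p <- s) p.1 \ox p.2 ->
  (forall p, p \in s -> commute3 p.1 y' z) -> commute3 x (m (y \ox y')) z.
Proof.
move=> h es hs; apply/commute3E; rewrite mul_twl mul_twr.
have [r er] := tensor_span (T (y' \ox z)).
(* The common value of both sides: the left one reaches it by the relation for y and [twr_twl], the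
   right one by the relation for y'. *)
transitivity (\sum_(q <- r) \sum_(p <- s)
    on23 (twl p.2) (T (p.1 \ox q.1) \ox q.2)).
  rewrite er !(tens_sumr, linear_sum); apply: eq_bigr => q _.
  have /commute3E hq := h q.2.
  rewrite twlE on12_twr hq es !(tens_suml, linear_sum).
  by apply: eq_bigr => p _; rewrite on23E twr_twl.
rewrite exchange_big es !(tens_suml, linear_sum, tens_suml) !big_seq.
apply: eq_bigr => p /hs/commute3E hp.
rewrite twrE on23_twl -hp er !(tens_sumr, linear_sum).
by apply: eq_bigr => q _; rewrite unassocE on12_tens.
Qed.

Section Derivation.
Variable d : {linear A -> A}.
Hypothesis T_dl :
  forall t, T (tmap d (idl A) t) = tmap d (idl A) (T t).
Hypothesis T_dr :
  forall t, T (tmap (idl A) d t) = tmap (idl A) d (T t).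

Lemma on12_commute (f : {linear A ⊗ A -> A ⊗ A}) t :
  (forall u, T (f u) = f (T u)) -> on12 T (on12 f t) = on12 f (on12 T t).
Proof.
move=> h; elim/tensor_ind: t => [|t u ht hu|t z]; first by rewrite !linear0.
  by rewrite !linearD ht hu.
by rewrite !on12_tens h.
Qed.

Lemma on23_commute (f : {linear A ⊗ A -> A ⊗ A}) t :
  (forall u, T (f u) = f (T u)) -> on23 T (on23 f t) = on23 f (on23 T t).
Proof.
move=> h; move: t; apply: (tensor3_eq (f := on23 T \o on23 f)
  (g := on23 f \o on23 T)) => x y z.
by rewrite /= !on23E !on23_unassoc h.
Qed.

Lemma commute3_d1 x y z : commute3 x y z -> commute3 (d x) y z.
Proof.
have e t : on23 T (on12 (tmap d (idl A)) t) = on12 (tmap d (idl A)) (on23 T t).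
  move: t; apply: (tensor3_eq (f := on23 T \o on12 (tmap d (idl A)))
    (g := on12 (tmap d (idl A)) \o on23 T)) => u v w.
  by rewrite /= on12E tmapE !on23E on12_tmapl.
rewrite /commute3 /commute_at => h.
have -> : (d x \ox y) \ox z = on12 (tmap d (idl A)) ((x \ox y) \ox z).
  by rewrite on12E tmapE.
by rewrite e !(on12_commute _ T_dl) e h.
Qed.

(** On the middle factor, d is read as A ⊗ d to pass T12 and as d ⊗ A to pass T23. *)
Lemma commute3_d2 x y z : commute3 x y z -> commute3 x (d y) z.
Proof.
rewrite /commute3 /commute_at => h.
have -> : (x \ox d y) \ox z = on12 (tmap (idl A) d) ((x \ox y) \ox z).
  by rewrite on12E tmapE.
rewrite (on12_commute _ T_dr) !on12_tmapr !(on23_commute _ T_dl).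
by rewrite -!on12_tmapr (on12_commute _ T_dr) h.
Qed.

Lemma commute3_d3 x y z : commute3 x y z -> commute3 x y (d z).
Proof.
have eE t w : on23 (tmap (idl A) d) (t \ox w) = t \ox d w.
  elim/tensor_ind: t => [|t u ht hu|u v].
  - by rewrite !tens0l linear0.
  - by rewrite !tensDl linearD ht hu.
  - by rewrite on23E tmapE unassocE.
have e t : on12 T (on23 (tmap (idl A) d) t) = on23 (tmap (idl A) d) (on12 T t).
  elim/tensor_ind: t => [|t u ht hu|t w]; first by rewrite !linear0.
    by rewrite !linearD ht hu.
  by rewrite eE !on12_tens eE.
rewrite /commute3 /commute_at => h.
have -> : (x \ox y) \ox d z = on23 (tmap (idl A) d) ((x \ox y) \ox z).
  by rewrite eE.
by rewrite e !(on23_commute _ T_dr) e h.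
Qed.

End Derivation.

End Commutation.

Lemma commute3_map (k : fieldType) (A B : algebra k) (i : {linear A -> B})
    (S : {linear A ⊗ A -> A ⊗ A}) (T : {linear B ⊗ B -> B ⊗ B}) x y z :
    (forall a b, T (i a \ox i b) = tmap i i (S (a \ox b))) ->
  commute3 S x y z -> commute3 T (i x) (i y) (i z).
Proof.
move=> hT; have h12 t : on12 T (tmap (tmap i i) i t) =
    tmap (tmap i i) i (on12 S t).
  move: t; apply: (tensor3_eq (f := on12 T \o tmap (tmap i i) i)
    (g := tmap (tmap i i) i \o on12 S)) => a b e.
  by rewrite /= !tmapE hT.
have h23 t : on23 T (tmap (tmap i i) i t) = tmap (tmap i i) i (on23 S t).
  move: t; apply: (tensor3_eq (f := on23 T \o tmap (tmap i i) i)
    (g := tmap (tmap i i) i \o on23 S)) => a b e.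
  rewrite /= !tmapE !on23E hT.
  elim/tensor_ind: (S _) => [|t u ht hu|u v].
  - by rewrite !(linear0, tens0r).
  - by rewrite !(linearD, tensDr) /= ht hu.
  - by rewrite tmapE !unassocE !tmapE.
rewrite /commute3 /commute_at => h.
have -> : (i x \ox i y) \ox i z = tmap (tmap i i) i ((x \ox y) \ox z).
  by rewrite !tmapE.
by rewrite h23 h12 h12 h23 h.
Qed.

(** The multiplicativity axioms turn the two bracketings into threefold products of T13 T23 T12 and
    T13 T12 T23, which agree by the commutation axiom. *)
Lemma twisted_algebra (k : fieldType) (A : algebra k)
    (c T : {linear A ⊗ A -> A ⊗ A}) :
  is_braided_twistor c T -> is_algebra (amul A \o T) (aone A).
Proof.
case=> h1 h2 h3 h4 h5; have [mA m1 m2] := algebraP A.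
have mA' t : amul A (on12 (amul A) t) = amul A (mul23 (amul A) t).
  move: t; apply: (tensor3_eq (f := amul A \o on12 (amul A))
    (g := amul A \o mul23 (amul A))) => x y z.
  by rewrite /= on12E mul23E mA.
split=> [x y z|x|x]; rewrite /= ?h1 ?h2 //.
pose w := (x \ox y) \ox z.
have -> : amul A (T (x \ox y)) \ox z = on12 (amul A) (on12 T w).
  by rewrite /w !on12_tens.
have -> : x \ox amul A (T (y \ox z)) = mul23 (amul A) (on23 T w).
  rewrite /w on23E; elim/tensor_ind: (T _) => [|t u ht hu|u v].
  - by rewrite !(linear0, tens0r).
  - by rewrite !(linearD, tensDr) /= ht hu.
  - by rewrite unassocE mul23E.
rewrite -[T (on12 _ _)]h4 -[T (mul23 _ _)]h3 /= mA'.
by have /= -> := h5 w.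
Qed.

(** * The differential graded structure of the twisted algebra *)

Section TwistedDga.
Variables (k : fieldType) (A : dga k) (T : {linear A ⊗ A -> A ⊗ A}).
Local Notation G := (dgr A).
Local Notation m := (amul A).
Local Notation d := (dd A).
Hypothesis T_bi : forall p q x y,
  homog G p x -> homog G q y -> bihomog G G p q (T (x \ox y)).
Hypothesis T_dl :
  forall t, T (tmap d (idl A) t) = tmap d (idl A) (T t).
Hypothesis T_dr :
  forall t, T (tmap (idl A) d t) = tmap (idl A) d (T t).

Lemma bihomog_mul p q t : bihomog G G p q t -> homog G (p + q)%N (m t).
Proof.
elim/bihomog_ind => [|u v hu hv|u v hu hv]; last exact: dga_mul.
  by rewrite /homog !linear0.
by rewrite /homog !linearD /= hu hv.
Qed.

Lemma bihomog_d p q t : bihomog G G p q t ->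
  d (m t) = m (tmap d (idl A) t) + (-1) ^+ p *: m (tmap (idl A) d t).
Proof.
elim/bihomog_ind => [|u v hu hv|u v hu hv].
- by rewrite !linear0 addr0.
- by rewrite !linearD /= hu hv addrACA.
- by have [_ _ _ _ h] := dgaP A; rewrite !tmapE; apply: h.
Qed.

(** All first components of T(x ⊗ y) have the degree p of x, so the Leibniz rule on T(x ⊗ y) carries
    the single sign (-1)^p; d then moves inside T. *)
Lemma twisted_dga c : is_braided_twistor c T ->
  is_dga G (m \o T) (aone A) d.
Proof.
move=> hT; split.
- exact: twisted_algebra hT.
- split=> [|p q x y hx hy]; first exact: dga_one.
  exact: bihomog_mul (T_bi hx hy).
- by move=> n x; apply: dga_d.
- by case: (dgaP A).
(* Only x is homogeneous here, while [T_bi] needs both; y is split into its components. *)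
move=> p x y hx; rewrite /= (hbound_sum G y) !(linear_sum, tens_sumr).
rewrite -big_split; apply: eq_bigr => q _ /=.
have hq := hcomp_homog G q y.
by rewrite (bihomog_d (T_bi hx hq)) -T_dl -T_dr !tmapE.
Qed.

End TwistedDga.

(** * The braided twistor axioms for the twisted extension *)

Section Main.
Variables (k : fieldType) (D : algebra k) (S : {linear D ⊗ D -> D ⊗ D}).
Hypothesis S_tw : is_twistor S.
Variables (Om : dga k) (i : {linear D -> Om}).
Variable Rt : {linear Om ⊗ Om -> Om ⊗ Om}.
Hypotheses (U : universal_forms i) (E : is_extension i (flip D D \o S) Rt).
Local Notation G := (dgr Om).
Local Notation m := (amul Om).
Local Notation d := (dd Om).
Local Notation c := (gflip G G).
Local Notation T := (c \o Rt : {linear Om ⊗ Om -> Om ⊗ Om}).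

(** As τ_gr is involutive, composing it with T gives back R̃, a twisting map; [twisting_iff] then
    yields every axiom but the commutation. *)
Lemma extension_twistor :
  [/\ forall x, T (aone Om \ox x) = aone Om \ox x,
      forall x, T (x \ox aone Om) = x \ox aone Om,
      mul23 m \o on13 c T \o on12 T =1 T \o mul23 m
    & on12 m \o on13 c T \o on23 T =1 T \o on12 m].
Proof.
apply: (iffLR (twisting_iff (@gflip_twisting _ Om) (@gflipK _ Om)
  (gflip_nat (twisted_bihomog U E)))).
by have [tw _ _ _] := E; apply: eq_is_twisting tw => t; rewrite /= gflipK.
Qed.

(** Passing from T13(τ_gr) to T13(τ) removes the signs, so that the ungraded commutation lemmas
    apply. *)
Lemma twisted_mulr : mul23 m \o on13 (flip Om Om) T \o on12 T =1 T \o mul23 m.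
Proof.
have [_ _ h _] := extension_twistor => t; rewrite -[RHS]h /=.
by rewrite (on13_gflip (twisted_bihomog U E)).
Qed.

Lemma twisted_mull : on12 m \o on13 (flip Om Om) T \o on23 T =1 T \o on12 m.
Proof.
have [_ _ _ h] := extension_twistor => t; rewrite -[RHS]h /=.
by rewrite (on13_gflip (twisted_bihomog U E)).
Qed.

Local Notation C := (commute3 T).

Lemma commute3_gen a b e : C (i a) (i b) (i e).
Proof.
apply: (commute3_map (S := S)) => [x y|].
  by rewrite (twisted_gen U E) /= flipK.
by have [_ _ _ _ h] := S_tw; apply: h.
Qed.

(** Induction on z, for all a and b at once: for z = xy, the first components of T(b ⊗ x) have
    degree 0 and take the place of b. *)
Lemma commute3_gen2 a b n z : homog G n z -> C (i a) (i b) z.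
Proof.
move=> hz; move: n z hz a b; apply: (universal_ind U) =>
  [n a b|n x y hx hy a b|n e x hx a b|e a b|n x hx h a b|
   p q x y hx hy IHx IHy a b].
- by rewrite /commute3 tens0r; apply: commute_at0.
- by rewrite /commute3 tensDr; apply: commute_atD; [apply: hx|apply: hy].
- by rewrite /commute3 tensZr; apply: commute_atZ; apply: hx.
- exact: commute3_gen.
- by apply: commute3_d3; [exact: twisted_dr E|apply: h].
have [s es hs] := bihomog_span (twisted_bihomog U E (gen_homog U b) hx).
apply: (commute3_mulr twisted_mulr (IHx a b) es) => r.
by move=> /hs/(homog0_gen U)[f ->]; apply: IHy.
Qed.

(** Induction on y, with z arbitrary: for a product, the first components of T(a ⊗ x) have degree 0
    and take the place of a. *)
Lemma commute3_gen1 a n y z : homog G n y -> C (i a) y z.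
Proof.
move=> hy; move: n y hy a z; apply: (universal_ind U) =>
  [n a z|n x y hx hy a z|n e x hx a z|b a z|n x hx h a z|
   p q x y hx hy IHx IHy a z].
- by rewrite /commute3 tens0r tens0l; apply: commute_at0.
- by rewrite /commute3 tensDr tensDl; apply: commute_atD; [apply: hx|apply: hy].
- by rewrite /commute3 tensZr tensZl; apply: commute_atZ; apply: hx.
- rewrite (hbound_sum G z) /commute3 tens_sumr.
  elim/big_ind: _ => [|u v|j _]; [exact: commute_at0|exact: commute_atD|].
  exact: commute3_gen2 (hcomp_homog _ _ _).
- by apply: commute3_d2; [exact: twisted_dl E|exact: twisted_dr E|apply: h].
have [s es hs] := bihomog_span (twisted_bihomog U E (gen_homog U a) hx).
apply: (commute3_mulm twisted_mulr twisted_mull (IHx a) es) => r.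
by move=> /hs/(homog0_gen U)[f ->]; apply: IHy.
Qed.

(** For a product in the first factor, [commute3_mull] asks for the relation at arbitrary middle
    elements, which the induction hypotheses provide. *)
Lemma commute3_hom n x y z : homog G n x -> C x y z.
Proof.
move=> hx; move: n x hx y z; apply: (universal_ind U) =>
  [n y z|n x x' hx hx' y z|n e x hx y z|a y z|n x hx h y z|
   p q x x' hx hx' IHx IHx' y z].
- by rewrite /commute3 !tens0l; apply: commute_at0.
- by rewrite /commute3 !tensDl; apply: commute_atD; [apply: hx|apply: hx'].
- by rewrite /commute3 !tensZl; apply: commute_atZ; apply: hx.
- rewrite (hbound_sum G y) /commute3 tens_sumr tens_suml.
  elim/big_ind: _ => [|u v|j _]; [exact: commute_at0|exact: commute_atD|].
  exact: commute3_gen1 (hcomp_homog _ _ _).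
- by apply: commute3_d1; [exact: twisted_dl E|apply: h].
by apply: (commute3_mull twisted_mull (IHx' y z)) => v; apply: IHx.
Qed.

Lemma twisted_commute : on12 T \o on23 T =1 on23 T \o on12 T.
Proof.
apply: (tensor3_heq (F := G) (G := G) (H := G) (f := on12 T \o on23 T)
  (g := on23 T \o on12 T)) => p q r x y z hx _ _.
exact: commute3_hom hx.
Qed.

Lemma twisted_graded_twistor : is_graded_twistor T.
Proof.
split; first exact: twisted_graded U E.
by have [h1 h2 h3 h4] := extension_twistor; split=> //; apply: twisted_commute.
Qed.

End Main.

Theorem theorem6p9 (k : fieldType) (D : algebra k)
    (T : {linear D ⊗ D -> D ⊗ D}) (hT : is_twistor T) :
  let R : {linear D ⊗ D -> D ⊗ D} := flip D D \o T in
  is_twisting R /\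
  forall (Om : dga k) (i : {linear D -> Om}), universal_forms i ->
  forall Rt : {linear Om ⊗ Om -> Om ⊗ Om}, is_extension i R Rt ->
  let Tt : {linear Om ⊗ Om -> Om ⊗ Om} := gflip (dgr Om) (dgr Om) \o Rt in
  is_graded_twistor Tt /\
  is_dga (dgr Om) (amul Om \o Tt) (aone Om) (dd Om).
Proof.
move=> R; split=> [|Om i U Rt E Tt].
  (* The ungraded instance of the same equivalence, with the ordinary flip as braiding. *)
  apply/(twisting_iff (@flip_twisting _ D) (@flipK _ D) (@flip_nat _ D T)).
  by case: hT => h1 h2 h3 h4 _; split.
have tw := twisted_graded_twistor hT U E; split=> //.
apply: (twisted_dga _ _ _ (proj2 tw)) => [p q x y|t|t].
- exact: (twisted_bihomog U E).
- exact: (twisted_dl E).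
- exact: (twisted_dr E).
Qed.
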